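(* Let $n\in\mathbb N$ and $\lambda>0$. Let $(B_1(t))_{t\ge0},\ldots,(B_n(t))_{t\ge0}$ be independent standard Brownian motions on $\mathbb R$, and let $X_1(t)\le\ldots\le X_n(t)$, $t\ge0$, be real-valued stochastic processes solving the stochastic differential equations $$dX_j=dB_j+\lambda\Bigg(\sum_{k\in\{1,\ldots,n\},\,k\ne j}\cot\frac{X_j-X_k}{2}\Bigg)dt,\qquad j=1,\ldots,n,$$ with initial condition $X_1(0)=\ldots=X_n(0)=0$. Put $P_{n,\lambda}(x;t):=\prod_{j=1}^n\left(x-e^{iX_j(t)}\right)$. Then for every $t\ge0$ and $x\in\mathbb C$, $$\mathbb E P_{n,\lambda}(x;t)=\sum_{j=0}^n(-1)^{n-j}\binom nj e^{-\frac12(n-j)t-\lambda j(n-j)t}x^j=e^{-\frac12nt}H_n(e^{t/2}x;2\lambda t).$$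
   Context: Unitary Hermite polynomials: for $n\in\mathbb N$ and $s\ge0$, $H_n(z;s)=\sum_{j=0}^n(-1)^{n-j}\binom nj \exp\{-\tfrac{s\,j(n-j)}{2}\}z^j$. *)

(* Defs.v *)
From HB Require Import structures.
From mathcomp Require Import all_boot all_order all_algebra.
From mathcomp Require Import complex.
From mathcomp Require Import all_classical all_reals all_analysis.

Set Implicit Arguments.
Unset Strict Implicit.
Unset Printing Implicit Defensive.
Import Order.TTheory GRing.Theory Num.Theory.
Import numFieldNormedType.Exports.

Local Open Scope classical_set_scope.
Local Open Scope complex_scope.
Local Open Scope ring_scope.

Section Deterministic.
Context {R : realType}.

(* Total: cot x = 0 when sin x = 0, by the convention a / 0 = 0. *)
Definition cot (x : R) : R := cos x / sin x.

(* exp (i x) for real x *)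
Definition expi (x : R) : R[i] := cos x +i* sin x.

Definition unitary_hermite (n : nat) (z : R[i]) (s : R) : R[i] :=
  \sum_(j < n.+1) (-1) ^+ (n - j) * 'C(n, j)%:R
    * (expR (- (s * j%:R * (n - j)%:R / 2)))%:C * z ^+ j.

End Deterministic.

Section Stochastic.
Context {d : measure_display} {T : measurableType d} {R : realType}.
Variable P : probability T R.

(* The sigma-algebra generated by the real functions Y i, i in A. *)
Definition sigma_of {I : Type} (A : set I) (Y : I -> T -> R) : set (set T) :=
  <<s \bigcup_(i in A) preimage_set_system setT (Y i) measurable >>.

Definition independent2 (G H : set (set T)) : Prop :=
  forall A B, G A -> H B -> P (A `&` B) = (P A * P B)%E.

Definition mutually_independent {I : finType} (G : I -> set (set T)) : Prop :=
  forall (J : {set I}) (E : I -> set T), (forall i, i \in J -> G i (E i)) ->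
    P (\bigcap_(i in [set` J]) E i) = (\prod_(i in J) P (E i))%E.

(* Processes are indexed by all of R; only the times t >= 0 matter. *)
Definition increment (Y : R -> {RV P >-> R}) (s t : R) (w : T) : R :=
  Y t w - Y s w.

Definition ae_continuous (Y : R -> {RV P >-> R}) : Prop :=
  {ae P, forall w, {within `[(0 : R), +oo[, continuous (fun t : R => (Y t w : R))}}.

(* The second parameter of normal_prob is the standard deviation. *)
Definition standard_brownian_motion (B : R -> {RV P >-> R}) : Prop :=
  [/\ {ae P, forall w, B 0 w = 0},
      ae_continuous B,
      (forall (k : nat) (tau : nat -> R), 0 <= tau 0 ->
         {homo tau : i j / (i <= j)%N >-> i <= j} ->
         mutually_independent (fun i : 'I_k =>
           sigma_of setT (fun _ : unit => increment B (tau i) (tau i.+1)))) &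
      (forall s t : R, 0 <= s -> s < t -> forall A : set R, measurable A ->
         P (increment B s t @^-1` A) = normal_prob 0 (Num.sqrt (t - s)) A)].

Definition independent_processes (n : nat) (B : 'I_n -> R -> {RV P >-> R}) :
    Prop :=
  mutually_independent
    (fun j => sigma_of [set t : R | 0 <= t] (fun t => B j t : T -> R)).

Definition filtration (F : R -> set (set T)) : Prop :=
  [/\ (forall t, 0 <= t -> sigma_algebra setT (F t)),
      (forall t, 0 <= t -> F t `<=` measurable) &
      (forall s t, 0 <= s -> s <= t -> F s `<=` F t)].

Definition adapted (F : R -> set (set T)) (Y : R -> {RV P >-> R}) : Prop :=
  forall t, 0 <= t -> preimage_set_system setT (Y t) measurable `<=` F t.

(* The filtration F is compatible with the n-dimensional Brownian motion B:
   B is adapted and its future increments are independent of the past. *)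
Definition brownian_filtration (n : nat) (F : R -> set (set T))
    (B : 'I_n -> R -> {RV P >-> R}) : Prop :=
  (forall j, adapted F (B j)) /\
  (forall s t, 0 <= s -> s <= t ->
     independent2 (F s) (sigma_of setT (fun j => increment (B j) s t))).

Definition cot_drift (n : nat) (lambda : R) (X : 'I_n -> R -> {RV P >-> R})
    (j : 'I_n) (s : R) (w : T) : R :=
  lambda * \sum_(k < n | k != j) cot ((X j s w - X k s w) / 2).

(* X solves  dX_j = dB_j + lambda (sum_(k != j) cot ((X_j - X_k) / 2)) dt.
   The noise is additive, so the integrated equation involves no stochastic
   integral. *)
Definition solves_sde (n : nat) (lambda : R) (F : R -> set (set T))
    (B X : 'I_n -> R -> {RV P >-> R}) : Prop :=
  [/\ (forall j, adapted F (X j)),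
      (forall j, ae_continuous (X j)) &
      {ae P, forall w, forall (j : 'I_n) (t : R), 0 <= t ->
         lebesgue_measure.-integrable `[0, t]
           (fun s => (cot_drift lambda X j s w)%:E) /\
         X j t w = X j 0 w + increment (B j) 0 t w
           + \int[lebesgue_measure]_(s in `[0, t]) cot_drift lambda X j s w}].

(* Random version of  prod_j (x - exp (i X_j(t))) *)
Definition circle_poly (n : nat) (X : 'I_n -> R -> {RV P >-> R}) (x : R[i])
    (t : R) (w : T) : R[i] :=
  \prod_(j < n) (x - expi (X j t w)).

Definition complex_integrable (Z : T -> R[i]) : Prop :=
  P.-integrable setT (fun w => (complex.Re (Z w))%:E) /\
  P.-integrable setT (fun w => (complex.Im (Z w))%:E).

Definition complex_expectation (Z : T -> R[i]) : R[i] :=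
  fine 'E_P[fun w => complex.Re (Z w)] +i* fine 'E_P[fun w => complex.Im (Z w)].

End Stochastic.

(* Main.v *)
(* For a set S of m indices put w_S(s) = e^(g s) cos (phi + \sum_(j in S) X_j(s))
   with g = m / 2 + lambda m (n - m).  The sum of w_S over all S of size m has
   constant expectation: the Brownian part contributes the rate - m / 2, and the
   cotangent drift the rate - lambda m (n - m), because exchanging j in S with k
   outside S pairs up the terms cot ((X_j - X_k) / 2) sin (...).  Expanding
   \prod_j (x - e^(i X_j)) over subsets then gives the moments.

   No stochastic integral is needed.  X - B has finite variation, so w_S is
   followed along a uniform grid of [0, t], with the conditional mean of each
   Brownian increment computed from its independence of the past, and the sums
   are stopped when the grid variation of X - B exceeds K.  The pairing fails at
   collision times (where cot is 0 by convention), but these are Lebesgue-null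
   almost surely: the same estimate applied to cos (theta (X_j - X_k)) shows that
   the Fourier transform of the occupation measure of X_j - X_k is O(1 / theta),
   so that this measure has no atoms. *)
Require Import Defs.
From mathcomp Require Import all_boot all_order all_algebra.
From mathcomp Require Import complex.
From mathcomp Require Import all_classical all_reals all_analysis.
From mathcomp Require Import perm measurable_realfun ring lra.

Set Implicit Arguments.
Unset Strict Implicit.
Unset Printing Implicit Defensive.
Import Order.TTheory GRing.Theory Num.Theory.
Import numFieldNormedType.Exports.

Local Open Scope classical_set_scope.
Local Open Scope complex_scope.
Local Open Scope ring_scope.

(** * Bounded measurable functions and independence *)

(** The obstacle is that the drift is only pathwise integrable: no moment of it, or of the variation
    of X - B, is available. Stopping at variation K makes every stopped sum bounded uniformly in the
    outcome, at the price of an event whose probability tends to 0 as K grows; so K is fixed first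
    and the mesh is refined afterwards. The stopping test is made at the left end of each step,
    where it belongs to the past and may multiply a function of the next Brownian increment.

    The cancellation takes place between different sets S and at a single time, whereas one step of
    the sum contains the integral of the drift times a sine frozen at the end of the step. The
    mismatch costs the oscillation of the path over a step times the integral of the absolute drift,
    and these costs add up to o(1) along almost every path.

    The free phase phi keeps the computation real: phi = 0 and phi = - pi / 2 give the real and
    imaginary parts of exp (i \sum_(j in S) X_j). *)

Section BoundedMeasurable.
Context {d : measure_display} {T : measurableType d} {R : realType}.
Implicit Types f g : T -> R.

Definition bounded_measurable f :=
  measurable_fun setT f /\ exists C : R, forall w, `|f w| <= C.

Lemma bm_cst (c : R) : bounded_measurable (fun=> c).
Proof. by split; [exact: measurable_cst|exists `|c|]. Qed.

Lemma bmD f g : bounded_measurable f -> bounded_measurable g ->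
  bounded_measurable (fun w => f w + g w).
Proof.
move=> [mf [C fC]] [mg [D gD]]; split; first exact: measurable_funD.
by exists (C + D) => w; rewrite (le_trans (ler_normD _ _))// lerD.
Qed.

Lemma bmM f g : bounded_measurable f -> bounded_measurable g ->
  bounded_measurable (fun w => f w * g w).
Proof.
move=> [mf [C fC]] [mg [D gD]]; split; first exact: measurable_funM.
by exists (C * D) => w; rewrite normrM ler_pM.
Qed.

Lemma bmN f : bounded_measurable f -> bounded_measurable (fun w => - f w).
Proof.
move=> [mf [C fC]]; split; first exact: measurableT_comp.
by exists C => w; rewrite normrN.
Qed.

Lemma bmB f g : bounded_measurable f -> bounded_measurable g ->
  bounded_measurable (fun w => f w - g w).
Proof. by move=> bf bg; apply: bmD => //; exact: bmN. Qed.

Lemma bmZ (c : R) f : bounded_measurable f ->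
  bounded_measurable (fun w => c * f w).
Proof. by move=> bf; apply: bmM => //; exact: bm_cst. Qed.

Lemma bm_sum (I : Type) (s : seq I) (Q : pred I) (f : I -> T -> R) :
  (forall i, Q i -> bounded_measurable (f i)) ->
  bounded_measurable (fun w => \sum_(i <- s | Q i) f i w).
Proof.
move=> bf; elim: s => [|i s IHs].
  rewrite (_ : (fun w => _) = fun=> 0); first exact: bm_cst.
  by apply/funext => w; rewrite big_nil.
have [Qi|/negbTE Qi] := boolP (Q i).
  rewrite (_ : (fun w => _) = fun w => f i w + \sum_(j <- s | Q j) f j w).
    by apply: bmD => //; exact: bf.
  by apply/funext => w; rewrite big_cons Qi.
rewrite (_ : (fun w => _) = fun w => \sum_(j <- s | Q j) f j w) //.
by apply/funext => w; rewrite big_cons Qi.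
Qed.

Lemma bm_prod (I : Type) (s : seq I) (Q : pred I) (f : I -> T -> R) :
  (forall i, Q i -> bounded_measurable (f i)) ->
  bounded_measurable (fun w => \prod_(i <- s | Q i) f i w).
Proof.
move=> bf; elim: s => [|i s IHs].
  rewrite (_ : (fun w => _) = fun=> 1); first exact: bm_cst.
  by apply/funext => w; rewrite big_nil.
have [Qi|/negbTE Qi] := boolP (Q i).
  rewrite (_ : (fun w => _) = fun w => f i w * \prod_(j <- s | Q j) f j w).
    by apply: bmM => //; exact: bf.
  by apply/funext => w; rewrite big_cons Qi.
rewrite (_ : (fun w => _) = fun w => \prod_(j <- s | Q j) f j w) //.
by apply/funext => w; rewrite big_cons Qi.
Qed.

Lemma bm_indic (A : set T) : measurable A -> bounded_measurable (\1_A : T -> R).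
Proof.
move=> mA; split; first exact: measurable_indic.
by exists 1 => w; rewrite indicE normr_nat lern1 leq_b1.
Qed.

Lemma bm_cos f : measurable_fun setT f -> bounded_measurable (fun w => cos (f w)).
Proof.
move=> mf; split; last by exists 1 => w; rewrite ler_norml cos_geN1 cos_le1.
apply: (measurableT_comp _ mf).
by apply: continuous_measurable_fun; exact: continuous_cos.
Qed.

Lemma bm_sin f : measurable_fun setT f -> bounded_measurable (fun w => sin (f w)).
Proof.
move=> mf; split; last by exists 1 => w; rewrite ler_norml sin_geN1 sin_le1.
apply: (measurableT_comp _ mf).
by apply: continuous_measurable_fun; exact: continuous_sin.
Qed.

Lemma bm_integrable (P : probability T R) f :
  bounded_measurable f -> P.-integrable setT (EFin \o f).
Proof.
move=> [mf [C fC]]; apply: measurable_bounded_integrable => //.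
  by have := ltry (1 : R); rewrite -(probability_setT P).
exists C; split; first exact: num_real.
by move=> M CM w _ /=; rewrite (le_trans (fC w))// ltW.
Qed.

Variable P : probability T R.
Notation Ex f := (\int[P]_w f w).

Lemma Ex_cst (c : R) : \int[P]_w c = c.
Proof. rewrite Rintegral_cst// -[RHS]mulr1; congr (_ * _).
exact: (congr1 fine (probability_setT P)). Qed.

Lemma ExD f g : bounded_measurable f -> bounded_measurable g ->
  \int[P]_w (f w + g w) = Ex f + Ex g.
Proof. by move=> bf bg; rewrite RintegralD//; exact: bm_integrable. Qed.

Lemma ExB f g : bounded_measurable f -> bounded_measurable g ->
  \int[P]_w (f w - g w) = Ex f - Ex g.
Proof. by move=> bf bg; rewrite RintegralB//; exact: bm_integrable. Qed.

Lemma ExZ (c : R) f : bounded_measurable f ->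
  \int[P]_w (c * f w) = c * Ex f.
Proof. by move=> bf; rewrite RintegralZl//; exact: bm_integrable. Qed.

Lemma Ex_sum (I : Type) (s : seq I) (Q : pred I) (f : I -> T -> R) :
  (forall i, Q i -> bounded_measurable (f i)) ->
  \int[P]_w (\sum_(i <- s | Q i) f i w) = \sum_(i <- s | Q i) Ex (f i).
Proof.
move=> bf; elim: s => [|i s IHs].
  under eq_Rintegral do rewrite big_nil.
  by rewrite Ex_cst big_nil.
rewrite big_cons -IHs; under eq_Rintegral do rewrite big_cons.
case: ifPn => // Qi; rewrite ExD//; first exact: bf.
exact: bm_sum.
Qed.

Lemma Ex_le f g : bounded_measurable f -> bounded_measurable g ->
  (forall w, f w <= g w) -> Ex f <= Ex g.
Proof. by move=> bf bg fg; apply: le_Rintegral => //; exact: bm_integrable. Qed.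

Lemma Ex_norm_le f (C : R) : bounded_measurable f ->
  (forall w, `|f w| <= C) -> `|Ex f| <= C.
Proof.
move=> bf fC; rewrite ler_norml; apply/andP; split.
  rewrite -[leLHS]Ex_cst; apply: Ex_le => //; first exact: bm_cst.
  by move=> w; have := fC w; rewrite ler_norml => /andP[].
rewrite -[leRHS]Ex_cst; apply: Ex_le => //; first exact: bm_cst.
by move=> w; have := fC w; rewrite ler_norml => /andP[].
Qed.

Lemma Ex_indic (A : set T) : measurable A -> \int[P]_w \1_A w = fine (P A).
Proof. by move=> mA; rewrite /Rintegral integral_indic// setIT. Qed.

End BoundedMeasurable.

(** The sum is the integer part of y: it counts the integers in 1, ..., k that do not exceed y. *)
Lemma sum_le_trunc (R : realType) (k : nat) (y : R) : 0 <= y -> y <= k%:R ->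
  y - 1 <= \sum_(l < k) (l.+1%:R <= y)%R%:R <= y.
Proof.
move=> y0; elim: k y y0 => [|k IHk] y y0 yk.
  by rewrite big_ord0; lra.
have [yk'|yk'] := lerP y k%:R.
  rewrite big_ord_recr/= [_.+1%:R <= y]lt_geF ?addr0; first exact: IHk.
  by rewrite (le_lt_trans yk')// ltr_nat.
rewrite big_ord_recr/= (eq_bigr (fun=> 1)); last first.
  by move=> i _; rewrite (le_trans _ (ltW yk'))// ler_nat.
rewrite sumr_const card_ord.
move: yk; rewrite -natr1 => yk.
by case: (lerP (k%:R + 1) y) => ky /=; lra.
Qed.

(* The step functions k^-1 \sum_(l < k) 1_{(l + 1) / k <= f} approximate a
   [0, 1]-valued f uniformly. *)
Lemma bm_functional_eq0 (d : measure_display) (T : measurableType d)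
    (R : realType) (L : (T -> R) -> R) (C : R) :
  (forall f g, bounded_measurable f -> bounded_measurable g ->
    L (fun w => f w + g w) = L f + L g) ->
  (forall c f, bounded_measurable f -> L (fun w => c * f w) = c * L f) ->
  (forall f (M : R), bounded_measurable f -> (forall w, `|f w| <= M) ->
    `|L f| <= C * M) ->
  (forall A, measurable A -> L \1_A = 0) ->
  forall f, bounded_measurable f -> L f = 0.
Proof.
move=> LD LZ LC LI.
have Lsum k (g : 'I_k -> T -> R) : (forall l, bounded_measurable (g l)) ->
    (forall l, L (g l) = 0) -> L (fun w => \sum_(l < k) g l w) = 0.
  move=> bg Lg; elim: k g bg Lg => [|k IHk] g bg Lg.
    rewrite (_ : (fun w => _) = fun w => 0 * (\1_set0 w : R)).
      by rewrite LZ ?mul0r//; apply: bm_indic.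
    by apply/funext => w; rewrite big_ord0 mul0r.
  rewrite (_ : (fun w => _) = fun w => \sum_(l < k) g (widen_ord (leqnSn k) l) w
      + g ord_max w); last by apply/funext => w; rewrite big_ord_recr.
  by rewrite LD ?IHk ?Lg ?addr0//; exact: bm_sum.
have L01 f : bounded_measurable f -> (forall w, 0 <= f w <= 1) -> L f = 0.
  move=> bf f01; apply/eqP; rewrite -normr_le0; apply/ler_addgt0Pr => e e0.
  rewrite add0r; pose k := (Num.trunc (`|C| / e)).+1.
  have k0 : 0 < k%:R :> R by rewrite ltr0n.
  have kV0 : 0 <= k%:R^-1 :> R by rewrite invr_ge0 ler0n.
  have ke : `|C| * k%:R^-1 <= e.
    rewrite ler_pdivrMr// [e * _]mulrC -ler_pdivrMr//; apply: ltW.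
    exact: truncnS_gt.
  pose A (l : 'I_k) := [set w | l.+1%:R <= k%:R * f w].
  have mA l : measurable (A l).
    have [mf _] := bmZ k%:R bf.
    have := mf measurableT `[l.+1%:R, +oo[%classic (measurable_itv _).
    rewrite setTI; congr measurable; apply/seteqP; split => w /=.
      by rewrite in_itv/= andbT.
    by rewrite /A/= in_itv/= andbT.
  pose g w : R := k%:R^-1 * \sum_(l < k) \1_(A l) w.
  have bS : bounded_measurable (fun w => \sum_(l < k) \1_(A l) w : R).
    by apply: bm_sum => l _; exact: bm_indic.
  have bg : bounded_measurable g by exact: bmZ.
  have Lg : L g = 0.
    by rewrite LZ// Lsum ?mulr0// => l; [exact: bm_indic|exact: LI].
  have bfg : bounded_measurable (fun w => f w - g w) by exact: bmB.
  have -> : L f = L (fun w => f w - g w).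
    rewrite -[RHS]addr0 -Lg -LD//; congr L.
    by apply/funext => w; rewrite subrK.
  have fg w : `|f w - g w| <= k%:R^-1.
    have /andP[f0 f1] := f01 w.
    have := @sum_le_trunc R k (k%:R * f w).
    rewrite mulr_ge0// ler_piMr// => /(_ isT isT).
    rewrite /g (eq_bigr (fun l => \1_(A l) w)); last first.
      move=> l _; rewrite indicE; congr (_%:R); rewrite /A.
      congr nat_of_bool; apply/idP/idP => [?|/set_mem//]; exact/mem_set.
    set S := \sum_(l < k) _ => /andP[S1 S2].
    have -> : f w - k%:R^-1 * S = k%:R^-1 * (k%:R * f w - S) by field; lra.
    by rewrite normrM (ger0_norm kV0) ler_piMr// ger0_norm; lra.
  apply: le_trans (LC _ _ bfg fg) _; apply: le_trans ke.
  by rewrite ler_wpM2r// ler_norm.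
move=> f bf; have [D fD] := bf.2.
(* An affine change brings f into [0, 1]; the summand 1 keeps c positive when D = 0, and the
   subtracted constant is a multiple of [\1_setT], on which L vanishes. *)
pose c := `|D| + 1; have c0 : 0 < c by rewrite /c ltr_wpDl.
have fE : f = fun w => 2 * c * ((f w + c) / (2 * c)) + (- c) * \1_setT w.
  by apply/funext => w; rewrite indicT/=; field; lra.
have bf' : bounded_measurable (fun w => (f w + c) / (2 * c)).
  by apply: bmM; [apply: bmD => //; exact: bm_cst|exact: bm_cst].
have bT : bounded_measurable (\1_setT : T -> R) by exact: bm_indic.
rewrite fE LD; [|exact: bmZ|exact: bmZ].
rewrite !LZ// LI// mulr0 addr0 L01 ?mulr0// => w.
have := fD w; have := ler_norm D; rewrite ler_norml => ? /andP[? ?].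
by rewrite divr_ge0 ?ler_pdivrMr /c; lra.
Qed.

Section Independence.
Context {d : measure_display} {T : measurableType d} {R : realType}.
Variable P : probability T R.

Lemma bm_sub (G : set (set T)) (f : T -> R) : <<s G >> `<=` measurable ->
  bounded_measurable (f : g_sigma_algebraType G -> R) -> bounded_measurable f.
Proof.
move=> sG [mf bf]; split => // _ A mA; rewrite setTI; apply: sG.
by have := mf measurableT A mA; rewrite setTI.
Qed.

(** One half of the passage from events to functions: V stays fixed while indicators are replaced by
    a bounded U. Applied once to each factor, it turns independence of events into a product formula
    for expectations. *)
Lemma Ex_mul_extend (G : set (set T)) (V U : T -> R) :
  <<s G >> `<=` measurable -> bounded_measurable V ->
  (forall A, <<s G >> A ->
    \int[P]_w (\1_A w * V w) = \int[P]_w \1_A w * \int[P]_w V w) ->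
  bounded_measurable (U : g_sigma_algebraType G -> R) ->
  \int[P]_w (U w * V w) = \int[P]_w U w * \int[P]_w V w.
Proof.
move=> sG bV indV bU; apply/eqP; rewrite -subr_eq0; apply/eqP.
have bs (f : T -> R) := @bm_sub G f sG.
have [D VD] := bV.2.
have D0 : 0 <= D by apply: le_trans (VD point).
pose L (f : g_sigma_algebraType G -> R) :=
  \int[P]_w (f w * V w) - \int[P]_w f w * \int[P]_w V w.
rewrite -/(L U); apply: (@bm_functional_eq0 _ _ _ L (2 * D)) => //.
- move=> f g /bs bf /bs bg; rewrite /L ExD//.
  under eq_Rintegral do rewrite mulrDl.
  by rewrite ExD; [ring|exact: bmM|exact: bmM].
- move=> c f /bs bf; rewrite /L ExZ//.
  under eq_Rintegral do rewrite -mulrA.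
  by rewrite ExZ; [ring|exact: bmM].
- move=> f M /bs bf fM; rewrite mulr2n mulrDl mulrDl mul1r.
  apply: le_trans (ler_normB _ _) _; rewrite [D * M]mulrC; apply: lerD.
    apply: Ex_norm_le => [|w]; first exact: bmM.
    by rewrite normrM ler_pM.
  by rewrite normrM; apply: ler_pM => //; exact: Ex_norm_le.
- by move=> A GA; rewrite /L indV// subrr.
Qed.

Lemma independent2_Ex (G H : set (set T)) (U V : T -> R) :
  <<s G >> `<=` measurable -> <<s H >> `<=` measurable ->
  independent2 P <<s G >> <<s H >> ->
  bounded_measurable (U : g_sigma_algebraType G -> R) ->
  bounded_measurable (V : g_sigma_algebraType H -> R) ->
  \int[P]_w (U w * V w) = \int[P]_w U w * \int[P]_w V w.
Proof.
move=> sG sH GH bU bV; have bV' := bm_sub sH bV.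
apply: (Ex_mul_extend sG) => // A GA.
under eq_Rintegral do rewrite mulrC.
rewrite mulrC; have mA := sG _ GA.
apply: (Ex_mul_extend sH) => //; first exact: bm_indic.
move=> B HB; have mB := sH _ HB.
under eq_Rintegral do rewrite -[_ * _]/((\1_B \* \1_A) _) -indicI.
rewrite !Ex_indic//; last exact: measurableI.
by rewrite setIC GH// fineM ?fin_num_measure// mulrC.
Qed.

Lemma mutually_independent_Ex (I : finType) (G : I -> set (set T))
    (U : I -> T -> R) :
  (forall i, <<s G i >> `<=` measurable) ->
  mutually_independent P (fun i => <<s G i >>) ->
  (forall i, bounded_measurable (U i : g_sigma_algebraType (G i) -> R)) ->
  \int[P]_w (\prod_i U i w) = \prod_i \int[P]_w U i w.
Proof.
move=> sG GI bU.
(* Induction on the set of indices whose factor is arbitrary: outside s the factors are still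
   indicators, so the empty list is the definition of independence. *)
pose ind (s : seq I) (U : I -> T -> R) := forall i, i \notin s ->
  exists2 A, <<s G i >> A & U i = \1_A.
suff: forall s, uniq s -> forall U,
    (forall i, bounded_measurable (U i : g_sigma_algebraType (G i) -> R)) ->
    ind s U -> \int[P]_w (\prod_i U i w) = \prod_i \int[P]_w U i w.
  move=> /(_ (enum I) (enum_uniq I)) /(_ U bU); apply => i.
  by rewrite mem_enum inE.
elim => [|k s IHs] => [_|/andP[ks us]] {bU}U bU Uind.
  have /choice[A HA] i : exists A, <<s G i >> A /\ U i = \1_A.
    by have [//|A GA UA] := Uind i; exists A.
  have /= := GI [set: I]%SET A (fun i _ => (HA i).1).
  have mA i : measurable (A i) := sG _ _ (HA i).1.
  have -> : \bigcap_(i in [set` [set: I]%SET]) A i = \bigcap_i A i.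
    by apply: eq_bigcapl; split => i //= _; rewrite inE.
  move=> PA; transitivity (fine (P (\bigcap_i A i))).
    rewrite -Ex_indic; last exact: fin_bigcap_measurable.
    apply: eq_Rintegral => w _.
    rewrite indicE; case: (boolP (w \in _)) => wA.
      rewrite big1// => i _; rewrite (HA i).2 indicE.
      by rewrite mem_set//; move/set_mem : wA; exact.
    have [i Ai] : exists i, ~ A i w.
      by apply/existsNP => wA'; move/negP : wA; apply; apply/mem_set => i _.
    rewrite (bigD1 i)//= (HA i).2 indicE memNset// mul0r//.
  rewrite PA; rewrite (eq_bigl xpredT); last by move=> i; rewrite inE.
  rewrite (eq_bigr (fun i => (\int[P]_w U i w)%:E)); last first.
    move=> i _; rewrite (HA i).2 Ex_indic// fineK//; exact: fin_num_measure.
  suff -> : (\prod_i (\int[P]_w U i w)%:E)%E = (\prod_i \int[P]_w U i w)%:E by [].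
  by elim/big_rec2 : _ => // i x y _ ->; rewrite EFinM.
pose V w := \prod_(i | i != k) U i w.
have bV : bounded_measurable V.
  by apply: bm_prod => i _; apply: (bm_sub (sG i)).
(* Replacing the factor k by an indicator brings the family back to the induction hypothesis;
   [Ex_mul_extend] then frees this factor, with the product of all the others as V. *)
pose U' (A : set T) i := if i == k then \1_A else U i.
have IH A : <<s G k >> A -> \int[P]_w (\1_A w * V w) =
    \int[P]_w \1_A w * \prod_(i | i != k) \int[P]_w U i w.
  move=> GA; have U'k : U' A k = \1_A by rewrite /U' eqxx.
  have := IHs us (U' A); rewrite (bigD1 k)//= U'k.
  rewrite [\prod_(i | i != k) _](eq_bigr (fun i => \int[P]_w U i w)); last first.
    by move=> i /negbTE ik; rewrite /U' ik.
  move=> <-.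
  - apply: eq_Rintegral => w _; rewrite [RHS](bigD1 k)//= /U' eqxx; congr (_ * _).
    by apply: eq_bigr => i /negbTE ->.
  - move=> i; rewrite /U'; case: eqVneq => [->|//].
    exact: bm_indic.
  - move=> i si; rewrite /U'; case: eqVneq => [->|ik]; first by exists A.
    by apply: Uind; rewrite inE negb_or ik.
have VE : \int[P]_w V w = \prod_(i | i != k) \int[P]_w U i w.
  have GT : <<s G k >> setT by exact: (@measurableT _ (g_sigma_algebraType (G k))).
  have := IH _ GT; rewrite Ex_indic// probability_setT mul1r => <-.
  by apply: eq_Rintegral => w _; rewrite indicT/= mul1r.
rewrite [RHS](bigD1 k)//= -VE -(@Ex_mul_extend (G k))//.
- by apply: eq_Rintegral => w _; rewrite (bigD1 k).
- by move=> A GA; rewrite VE IH.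
Qed.

End Independence.

(** * Gaussian integrals of trigonometric functions *)

Lemma normr_le_derive (R : realType) (f df : R -> R) (c u : R) :
  (forall x : R, is_derive x 1 f (df x)) -> f 0 = 0 -> 0 <= u ->
  (forall v, 0 <= v <= u -> `|df v| <= c) -> `|f u| <= c * u.
Proof.
move=> fdf f0 u0 dfc.
have cf : {within `[0, u], continuous f}.
  apply: derivable_within_continuous => x _.
  exact: (@ex_derive _ _ _ _ _ _ _ (fdf x)).
have [v] := MVT_segment u0 (fun x _ => fdf x) cf.
rewrite in_itv/= f0 !subr0 => uv ->.
by rewrite normrM (ger0_norm u0) ler_wpM2r// dfc.
Qed.

(* Reduces Gaussian integrals of cosines to the exponential moments, which are
   known in closed form. *)
Lemma cos_cosh_le (R : realType) (u : R) :
  `|cos u + (expR u + expR (- u)) / 2 - 2| <= 2 * expR `|u| * `|u| ^+ 4.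
Proof.
wlog u0 : u / 0 <= u.
  move=> wl; have [/wl//|/ltW u0] := lerP 0 u.
  have := wl (- u); rewrite oppr_ge0 cosN opprK normrN => /(_ u0).
  by rewrite [expR (- u) + _]addrC.
rewrite (ger0_norm u0).
(* D1, ..., D4 are the successive derivatives of D0, and D0, ..., D3 vanish at 0. The bound 2 exp u
   on D4 is thus integrated four times, each time gaining a factor u. *)
pose D4 (x : R) := cos x + (expR x + expR (- x)) / 2.
pose D3 (x : R) := sin x + (expR x - expR (- x)) / 2.
pose D2 (x : R) := - cos x + (expR x + expR (- x)) / 2.
pose D1 (x : R) := - sin x + (expR x - expR (- x)) / 2.
pose D0 (x : R) := cos x + (expR x + expR (- x)) / 2 - 2.
have c0 : 0 <= 2 * expR u by rewrite mulr_ge0// expR_ge0.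
have D4c v : 0 <= v <= u -> `|D4 v| <= 2 * expR u.
  move=> /andP[v0 vu]; have e1 : 1 <= expR u by rewrite -expR0 ler_expR.
  have ev : expR v <= expR u by rewrite ler_expR.
  have eNv : expR (- v) <= expR u by rewrite ler_expR; lra.
  have := cos_le1 v; have := cos_geN1 v.
  have := expR_gt0 v; have := expR_gt0 (- v).
  by rewrite ler_norml /D4; lra.
have mono (v : R) k : 0 <= v <= u -> 2 * expR u * u ^+ k * v <= 2 * expR u * u ^+ k.+1.
  by move=> /andP[v0 vu]; rewrite exprSr mulrA ler_wpM2l// mulr_ge0// exprn_ge0.
have D3c v : 0 <= v <= u -> `|D3 v| <= 2 * expR u * u ^+ 1.
  move=> vu; apply: le_trans (mono v 0%N vu); rewrite expr0 mulr1.
  case/andP: vu => v0 vu; apply: (@normr_le_derive _ _ D4) => //.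
  - move=> x; apply: is_derive_eq; rewrite /D4/= /GRing.scale/=; lra.
  - by rewrite /D3 sin0 oppr0 subrr mul0r addr0.
  - by move=> w /andP[w0 wv]; apply: D4c; rewrite w0 (le_trans wv).
have D2c v : 0 <= v <= u -> `|D2 v| <= 2 * expR u * u ^+ 2.
  move=> vu; apply: le_trans (mono v 1%N vu).
  case/andP: vu => v0 vu; apply: (@normr_le_derive _ _ D3) => //.
  - move=> x; apply: is_derive_eq; rewrite /D3/= /GRing.scale/=; lra.
  - by rewrite /D2 cos0 oppr0 expR0; lra.
  - by move=> w /andP[w0 wv]; apply: D3c; rewrite w0 (le_trans wv).
have D1c v : 0 <= v <= u -> `|D1 v| <= 2 * expR u * u ^+ 3.
  move=> vu; apply: le_trans (mono v 2%N vu).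
  case/andP: vu => v0 vu; apply: (@normr_le_derive _ _ D2) => //.
  - move=> x; apply: is_derive_eq; rewrite /D2/= /GRing.scale/=; lra.
  - by rewrite /D1 sin0 !oppr0 subrr mul0r addr0.
  - by move=> w /andP[w0 wv]; apply: D2c; rewrite w0 (le_trans wv).
have uu : 0 <= u <= u by rewrite u0 lexx.
apply: le_trans (mono u 3%N uu).
apply: (@normr_le_derive _ D0 D1) => //.
- move=> x; apply: is_derive_eq; rewrite /D1/= /GRing.scale/=; lra.
- by rewrite /D0 cos0 oppr0 expR0; lra.
Qed.

(** The fourth power of z <= exp z at z = |y| / 4; the constant is 4 ^ 4. *)
Lemma expr4_le_expR (R : realType) (y : R) : `|y| ^+ 4 <= 256 * expR `|y|.
Proof.
have -> : expR `|y| = expR (`|y| / 4) ^+ 4.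
  by rewrite -expRM_natl; congr expR; field.
have -> : `|y| = 4 * (`|y| / 4) by field.
set z := `|y| / 4; have z0 : 0 <= z by rewrite /z divr_ge0.
rewrite [4 * z / 4](_ : _ = z); last by field.
rewrite exprMn (_ : 4 ^+ 4 = 256 :> R); last by ring.
rewrite ler_pM2l; last by lra.
apply: lerXn2r; rewrite ?nnegrE ?expR_ge0//.
by apply: le_trans (expR_ge1Dx z); rewrite lerDr.
Qed.

Section Gaussian.
Context {R : realType}.
Notation mu := (@lebesgue_measure R).

(** Completing the square turns the integrand into a constant times the normal density with mean c
    sigma ^ 2. *)
Lemma integral_expR_normal_pdf (c sigma : R) : sigma != 0 ->
  (\int[mu]_x (expR (c * x) * normal_pdf 0 sigma x)%:E =
   (expR (c ^+ 2 * sigma ^+ 2 / 2))%:E)%E.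
Proof.
move=> s0; transitivity (\int[mu]_x ((expR (c ^+ 2 * sigma ^+ 2 / 2))%:E *
    (normal_pdf (c * sigma ^+ 2) sigma x)%:E))%E.
  apply: eq_integral => x _; rewrite -EFinM; congr EFin.
  rewrite !normal_pdfE// mulrCA [RHS]mulrCA; congr (_ * _).
  rewrite /normal_fun -!expRD; congr expR; field.
  by rewrite s0.
rewrite integralZl//; last exact: integrable_normal_pdf.
by rewrite integral_normal_pdf mule1.
Qed.

Lemma integrable_expR_normal_pdf (c sigma : R) : sigma != 0 ->
  mu.-integrable setT (fun x => (expR (c * x) * normal_pdf 0 sigma x)%:E).
Proof.
move=> s0; apply/integrableP; split.
  apply/measurable_EFinP; apply: measurable_funM; last exact: measurable_normal_pdf.
  by apply: measurableT_comp => //; exact: measurable_funM.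
under eq_integral do rewrite gee0_abs ?lee_fin ?mulr_ge0 ?expR_ge0 ?normal_pdf_ge0//.
by rewrite integral_expR_normal_pdf// ltry.
Qed.

Lemma bm_normal_integrable (sigma : R) (f : R -> R) : bounded_measurable f ->
  mu.-integrable setT (fun x => (f x * normal_pdf 0 sigma x)%:E).
Proof.
move=> [mf [M fM]].
have M0 : 0 <= M by apply: le_trans (fM 0).
have iN := integrable_normal_pdf 0 sigma.
apply: le_integrable; [exact: measurableT| | |exact: (integrableZl measurableT M iN)].
- apply/measurable_EFinP; apply: measurable_funM => //.
  exact: measurable_normal_pdf.
- move=> x _; rewrite !abse_EFin lee_fin !normrM (ger0_norm M0).
  by rewrite ler_wpM2r.
Qed.

Definition gaussE (sigma : R) (f : R -> R) : R :=
  \int[mu]_x (f x * normal_pdf 0 sigma x).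

Lemma gaussE_norm_le sigma (f : R -> R) (M : R) : bounded_measurable f ->
  (forall x, `|f x| <= M) -> `|gaussE sigma f| <= M.
Proof.
move=> bf fM; have iN := integrable_normal_pdf 0 sigma.
apply: le_trans (le_normr_Rintegral _ (bm_normal_integrable _ bf)) _ => //.
apply: (@le_trans _ _ (\int[mu]_x (M * normal_pdf 0 sigma x))).
  apply: le_Rintegral => //.
  - have := integrable_norm (bm_normal_integrable sigma bf).
    by apply: eq_integrable => // x _.
  - exact: (@integrableZl _ _ _ mu setT measurableT _ _ iN).
  - by move=> x _; rewrite normrM (ger0_norm (normal_pdf_ge0 _ _ _)) ler_wpM2r// normal_pdf_ge0.
rewrite RintegralZl// /Rintegral integral_normal_pdf/= mulr1//.
Qed.

Lemma gaussE_sin sigma a : sigma != 0 -> gaussE sigma (fun x => sin (a * x)) = 0.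
Proof.
(* Oddness of the sine. The reflection x -> - x is applied on half-lines to nonnegative integrands,
   so 1 is added to the sine; comparing the integrals of G x and G (- x) then gives I = - I. *)
move=> s0; pose G (x : R) := (1 + sin (a * x)) * normal_pdf 0 sigma x.
have G0 x : 0 <= G x.
  by rewrite mulr_ge0 ?normal_pdf_ge0//; have := sin_geN1 (a * x); lra.
have cG : continuous G.
  move=> x; apply: cvgM; last exact: continuous_normal_pdf.
  apply: cvgD; first exact: cvg_cst.
  apply: (@continuous_comp _ _ _ (fun x => a * x) sin); last exact: continuous_sin.
  exact: mulrl_continuous.
have cGN : continuous (G \o -%R).
  by move=> x; apply: continuous_comp; [exact: opp_continuous|exact: cG].
have half (H : R -> R) : continuous H -> (forall x, 0 <= H x) ->
    (\int[mu]_(x in `]-oo, 0%R]) (H x)%:E = \int[mu]_(x in `[0%R, +oo[) (H (- x))%:E)%E.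
  move=> cH H0; rewrite -{1}(oppr0 R) ge0_integration_by_substitutionNy//.
  by rewrite oppr0; apply: continuous_subspaceT.
have split (H : R -> R) : continuous H -> (forall x, 0 <= H x) ->
    (\int[mu]_x (H x)%:E = \int[mu]_(x in `]-oo, 0%R]) (H x)%:E +
       \int[mu]_(x in `[0%R, +oo[) (H x)%:E)%E.
  move=> cH H0.
  have mH D : measurable_fun D (fun x => (H x)%:E).
    apply: measurable_funTS; apply/measurable_EFinP.
    exact: continuous_measurable_fun.
  rewrite -(@integral_itv_obnd_cbnd _ 0 +oo%O)//.
  rewrite -ge0_integral_setU//.
  - congr (integral _ _ _); rewrite -itv_bndbnd_setU//.
    by rewrite set_itvNyy.
  - exact: mH.
  - by move=> x _; rewrite lee_fin.
  - by apply/disj_setPS => x [/=]; rewrite !in_itv/= andbT leNgt => /negP.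
have GN : (\int[mu]_(x in `]-oo, 0%R]) (G (- x))%:E =
    \int[mu]_(x in `[0%R, +oo[) (G x)%:E)%E.
  have := half (G \o -%R) cGN (fun x => G0 (- x)).
  by under [in X in _ = X -> _]eq_integral do rewrite /= opprK.
have : (\int[mu]_x (G x)%:E = \int[mu]_x (G (- x))%:E)%E.
  transitivity (\int[mu]_(x in `]-oo, 0%R]) (G (- x))%:E +
      \int[mu]_(x in `[0%R, +oo[) (G (- x))%:E)%E.
    by rewrite (split G)// (half G)// GN addeC.
  by rewrite (split (G \o -%R) cGN (fun x => G0 (- x))).
have bs : bounded_measurable (fun x : R => sin (a * x)).
  by apply: bm_sin; exact: measurable_funM.
have i1 := bm_normal_integrable sigma (@bm_cst _ _ R 1).
have isin := bm_normal_integrable sigma bs.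
move=> /(congr1 fine).
have -> : fine (\int[mu]_x (G x)%:E)%E = gaussE sigma (fun=> 1) +
    gaussE sigma (fun x => sin (a * x)).
  by rewrite -RintegralD//; congr fine; apply: eq_integral => x _; rewrite /G mulrDl.
have -> : fine (\int[mu]_x (G (- x))%:E)%E = gaussE sigma (fun=> 1) -
    gaussE sigma (fun x => sin (a * x)).
  rewrite -RintegralB//; congr fine; apply: eq_integral => x _.
  by rewrite /G mulrN sinN -mulrBl !normal_pdfE// /normal_fun !subr0 sqrrN.
by lra.
Qed.

(** Up to a fourth-order error cos u is 2 - cosh u, and cosh (a x) has mean exp ((a sigma) ^ 2 / 2).
    With y = x / sigma and |a sigma| <= 1, the error is at most 2 * 256 (a sigma) ^ 4 exp (2 |y|),
    and exp (2 |y|) <= exp (2 y) + exp (- 2 y) has mean at most 2 exp 2; hence 1024 exp 2. *)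
Lemma gaussE_cos (sigma a : R) : 0 < sigma -> `|a * sigma| <= 1 ->
  `|gaussE sigma (fun x => cos (a * x)) - (2 - expR ((a * sigma) ^+ 2 / 2))|
    <= 1024 * expR 2 * (a * sigma) ^+ 4.
Proof.
move=> s_gt0 as1; have s0 : sigma != 0 by rewrite gt_eqF.
pose D (x : R) := cos (a * x) + (expR (a * x) + expR (- (a * x))) / 2 - 2.
pose c := 512 * `|a * sigma| ^+ 4.
have c0 : 0 <= c by rewrite mulr_ge0// exprn_ge0.
have Dle x : `|D x| <= c * (expR (2 / sigma * x) + expR (- 2 / sigma * x)).
  apply: le_trans (cos_cosh_le (a * x)) _.
  have -> : a * x = (a * sigma) * (x / sigma) by field.
  have -> : 2 / sigma * x = 2 * (x / sigma) by ring.
  have -> : - 2 / sigma * x = - (2 * (x / sigma)) by ring.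
  set y := x / sigma; rewrite normrM.
  have ey : expR (2 * `|y|) <= expR (2 * y) + expR (- (2 * y)).
    have [y0|y0] := lerP 0 y; first by rewrite ger0_norm// lerDl expR_ge0.
    by rewrite ltr0_norm// mulrN lerDr expR_ge0.
  apply: le_trans (_ : c * expR (2 * `|y|) <= _); last by rewrite ler_wpM2l.
  rewrite exprMn mulrCA mulrA /c.
  have e2 : expR (2 * `|y|) = expR `|y| * expR `|y| by rewrite -expRD; congr expR; ring.
  have h1 : expR (`|a * sigma| * `|y|) <= expR `|y|.
    by rewrite ler_expR ler_piMl.
  have h2 := expr4_le_expR y.
  have h3 : expR (`|a * sigma| * `|y|) * `|y| ^+ 4 <= expR `|y| * (256 * expR `|y|).
    by apply: ler_pM => //; rewrite ?expR_ge0// exprn_ge0.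
  rewrite e2.
  have -> : `|a * sigma| ^+ 4 * (2 * expR (`|a * sigma| * `|y|)) * `|y| ^+ 4 =
     2 * `|a * sigma| ^+ 4 * (expR (`|a * sigma| * `|y|) * `|y| ^+ 4) by ring.
  have -> : 512 * `|a * sigma| ^+ 4 * (expR `|y| * expR `|y|) =
     2 * `|a * sigma| ^+ 4 * (expR `|y| * (256 * expR `|y|)) by ring.
  by rewrite ler_wpM2l// mulr_ge0// exprn_ge0.
have ie k := integrable_expR_normal_pdf k s0.
have bc : bounded_measurable (fun x : R => cos (a * x)).
  by apply: bm_cos; exact: measurable_funM.
have ic := bm_normal_integrable sigma bc.
have i1 := bm_normal_integrable sigma (@bm_cst _ _ R 2).
have Ek k : \int[mu]_x (expR (k * x) * normal_pdf 0 sigma x) =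
    expR (k ^+ 2 * sigma ^+ 2 / 2).
  by rewrite /Rintegral integral_expR_normal_pdf.
have i2 : mu.-integrable setT
    (EFin \o (fun x => expR (a * x) * normal_pdf 0 sigma x +
       expR (- a * x) * normal_pdf 0 sigma x)).
  exact: (integrableD measurableT (ie a) (ie (- a))).
have i3 : mu.-integrable setT
    (EFin \o (fun x => 2^-1 * (expR (a * x) * normal_pdf 0 sigma x +
       expR (- a * x) * normal_pdf 0 sigma x))).
  exact: (integrableZl measurableT 2^-1 i2).
have i4 : mu.-integrable setT
    (EFin \o (fun x => cos (a * x) * normal_pdf 0 sigma x +
       2^-1 * (expR (a * x) * normal_pdf 0 sigma x +
       expR (- a * x) * normal_pdf 0 sigma x))).
  exact: (integrableD measurableT ic i3).
have DE x : D x * normal_pdf 0 sigma x = cos (a * x) * normal_pdf 0 sigma x +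
       2^-1 * (expR (a * x) * normal_pdf 0 sigma x +
       expR (- a * x) * normal_pdf 0 sigma x) - 2 * normal_pdf 0 sigma x.
  by rewrite /D mulNr; field.
have iD : mu.-integrable setT (EFin \o (fun x => D x * normal_pdf 0 sigma x)).
  rewrite (_ : _ \o _ = EFin \o (fun x => cos (a * x) * normal_pdf 0 sigma x +
       2^-1 * (expR (a * x) * normal_pdf 0 sigma x +
       expR (- a * x) * normal_pdf 0 sigma x) - 2 * normal_pdf 0 sigma x)).
    exact: (integrableB measurableT i4 i1).
  by apply/funext => x /=; rewrite DE.
have -> : gaussE sigma (fun x => cos (a * x)) - (2 - expR ((a * sigma) ^+ 2 / 2)) =
    \int[mu]_x (D x * normal_pdf 0 sigma x).
  under [in RHS]eq_Rintegral do rewrite DE.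
  rewrite (RintegralB measurableT i4 i1) (RintegralD measurableT ic i3).
  rewrite (RintegralZl _ measurableT i2) (RintegralD measurableT (ie a) (ie (- a))).
  rewrite !Ek (RintegralZl _ measurableT (integrable_normal_pdf 0 sigma)).
  rewrite [\int[mu]_x normal_pdf 0 sigma x]/Rintegral integral_normal_pdf/=.
  by rewrite sqrrN exprMn /gaussE; field.
apply: le_trans (le_normr_Rintegral measurableT iD) _.
have i5 : mu.-integrable setT
    (EFin \o (fun x => expR (2 / sigma * x) * normal_pdf 0 sigma x +
       expR (- 2 / sigma * x) * normal_pdf 0 sigma x)).
  exact: (integrableD measurableT (ie (2 / sigma)) (ie (- 2 / sigma))).
apply: (@le_trans _ _ (\int[mu]_x (c * (expR (2 / sigma * x) * normal_pdf 0 sigma x +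
       expR (- 2 / sigma * x) * normal_pdf 0 sigma x)))).
  apply: le_Rintegral => //.
  - exact: (integrable_norm iD).
  - exact: (integrableZl measurableT c i5).
  - move=> x _; rewrite normrM (ger0_norm (normal_pdf_ge0 _ _ _)) -mulrDl mulrA.
    by rewrite ler_wpM2r// normal_pdf_ge0.
rewrite (RintegralZl _ measurableT i5).
rewrite (RintegralD measurableT (ie (2 / sigma)) (ie (- 2 / sigma))) !Ek.
have -> : (2 / sigma) ^+ 2 * sigma ^+ 2 / 2 = 2 by field.
have -> : (- 2 / sigma) ^+ 2 * sigma ^+ 2 / 2 = 2 by field.
rewrite /c -normrX ger0_norm; last by rewrite exprn_even_ge0.
by rewrite le_eqVlt; apply/orP; left; apply/eqP; ring.
Qed.

Lemma gaussE_law (d : measure_display) (T : measurableType d)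
    (P : probability T R) (Y : T -> R) (sigma : R) (f : R -> R) :
  measurable_fun setT Y ->
  (forall A, measurable A -> P (Y @^-1` A) = normal_prob 0 sigma A) ->
  bounded_measurable f -> \int[P]_w f (Y w) = gaussE sigma f.
Proof.
move=> mY lawY bf; apply/eqP; rewrite -subr_eq0; apply/eqP.
have bY (g : R -> R) : bounded_measurable g -> bounded_measurable (g \o Y).
  move=> [mg [M gM]]; split; first exact: measurableT_comp.
  by exists M => w; exact: gM.
pose L (g : R -> R) := \int[P]_w g (Y w) - gaussE sigma g.
rewrite -/(L f); apply: (@bm_functional_eq0 _ _ _ L 2) => //.
- move=> g h bg bh; rewrite /L /gaussE.
  rewrite (ExD P (bY _ bg) (bY _ bh)).
  under [X in _ - X]eq_Rintegral do rewrite mulrDl.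
  rewrite (RintegralD measurableT (bm_normal_integrable _ bg) (bm_normal_integrable _ bh)).
  by rewrite /=; ring.
- move=> c g bg; rewrite /L /gaussE (ExZ P c (bY _ bg)).
  under [X in _ - X]eq_Rintegral do rewrite -mulrA.
  rewrite (RintegralZl _ measurableT (bm_normal_integrable _ bg)).
  by rewrite /=; ring.
- move=> g M bg gM; rewrite mulr2n mulrDl mul1r; apply: le_trans (ler_normB _ _) _.
  apply: lerD; last exact: gaussE_norm_le.
  by apply: (Ex_norm_le _ (bY _ bg)) => w; exact: gM.
- move=> A mA; rewrite /L /gaussE.
  have mYA : measurable (Y @^-1` A) by rewrite -[X in measurable X]setTI; exact: mY.
  have -> : \int[P]_w \1_A (Y w) = \int[P]_w \1_(Y @^-1` A) w by [].
  rewrite Ex_indic// lawY// /normal_prob.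
  apply/eqP; rewrite subr_eq0; apply/eqP; congr fine.
  rewrite [LHS]integral_mkcond; apply: eq_integral => x _.
  by rewrite patchE indicE; case: ifPn => xA; rewrite ?mul1r ?mul0r.
Qed.

End Gaussian.

(** * Mean cosines of independent sums and of Brownian increments *)

Section CosineSums.
Context {d : measure_display} {T : measurableType d} {R : realType}.
Variable P : probability T R.

(** The product formula for characteristic functions of symmetric variables, in real form. Peeling
    off Z_k leaves a cosine term with phase phi and a sine term with phase phi + pi / 2; the second
    vanishes because sin Z_k has mean 0. *)
Lemma Ex_cos_sum (I : finType) (G : I -> set (set T)) (Z : I -> T -> R)
    (c : I -> R) (phi : R) :
  (forall i, <<s G i >> `<=` measurable) ->
  mutually_independent P (fun i => <<s G i >>) ->
  (forall i, measurable_fun setT (Z i : g_sigma_algebraType (G i) -> R)) ->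
  (forall i, \int[P]_w cos (Z i w) = c i) ->
  (forall i, \int[P]_w sin (Z i w) = 0) ->
  \int[P]_w cos (phi + \sum_i Z i w) = cos phi * \prod_i c i.
Proof.
move=> sG GI mZ cZ sZ.
have mZT i : measurable_fun setT (Z i).
  move=> _ A mA; rewrite setTI; apply: (sG i).
  by have := mZ i measurableT A mA; rewrite setTI.
(* The extra factors U_i outside the list are there to absorb cos Z_k or sin Z_k when k leaves the
   list. *)
suff: forall s : seq I, uniq s -> forall phi (U : I -> T -> R),
    (forall i, bounded_measurable (U i : g_sigma_algebraType (G i) -> R)) ->
    \int[P]_w (cos (phi + \sum_(i <- s) Z i w) * \prod_(i | i \notin s) U i w) =
    cos phi * \prod_(i <- s) c i * \prod_(i | i \notin s) \int[P]_w U i w.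
  move=> /(_ (enum I) (enum_uniq I) phi (fun _ _ => 1)) /(_ (fun i => bm_cst _)).
  have nE (i : I) : (i \notin enum I) = false by rewrite mem_enum.
  rewrite big_enum/= [X in _ = _ * X -> _]big_pred0// mulr1 => <-.
  by apply: eq_Rintegral => w _; rewrite [X in _ = _ * X]big_pred0// mulr1 big_enum.
elim => [|k s IHs] => [_|/andP[ks us]] {}phi U bU.
  rewrite big_nil mulr1 -(@mutually_independent_Ex _ _ _ P _ G U)//.
  rewrite -ExZ; last by apply: bm_prod => i _; exact: (bm_sub (sG i)).
  by apply: eq_Rintegral => w _; rewrite big_nil addr0.
pose V w := \prod_(i | i \notin k :: s) U i w.
have bV : bounded_measurable V by apply: bm_prod => i _; exact: (bm_sub (sG i)).
pose v := \prod_(i | i \notin k :: s) \int[P]_w U i w.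
have IH psi (f : T -> R) : bounded_measurable (f : g_sigma_algebraType (G k) -> R) ->
    \int[P]_w (cos (psi + \sum_(i <- s) Z i w) * (f w * V w)) =
    cos psi * \prod_(i <- s) c i * (\int[P]_w f w * v).
  move=> bf; pose U' i := if i == k then f else U i.
  have U'k : U' k = f by rewrite /U' eqxx.
  have U'n i : (i \notin s) && (i != k) -> U' i = U i.
    by move=> /andP[_ /negbTE ik]; rewrite /U' ik.
  have pE i : (i \notin s) && (i != k) = (i \notin k :: s).
    by rewrite inE negb_or andbC.
  have := IHs us psi U'; rewrite [\prod_(i | i \notin s) \int[P]_w _](bigD1 k)//=.
  rewrite U'k [\prod_(i | _ && _) _](eq_bigr (fun i => \int[P]_w U i w)); last first.
    by move=> i /U'n ->.
  rewrite (eq_bigl _ _ pE) -/v => <-.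
    apply: eq_Rintegral => w _; congr (_ * _); rewrite [RHS](bigD1 k)//= U'k.
    congr (_ * _); rewrite (eq_bigr (fun i => U i w)); last by move=> i /U'n ->.
    by rewrite (eq_bigl _ _ pE).
  by move=> i; rewrite /U'; case: eqVneq => [->|].
have mS : measurable_fun setT (fun w => \sum_(i <- s) Z i w).
  exact: measurable_sum.
have mS' psi : measurable_fun setT (fun w => psi + \sum_(i <- s) Z i w).
  by apply: measurable_funD.
transitivity (\int[P]_w (cos (phi + \sum_(i <- s) Z i w) * (cos (Z k w) * V w) +
    cos (phi + pi / 2 + \sum_(i <- s) Z i w) * (sin (Z k w) * V w))).
  apply: eq_Rintegral => w _; rewrite big_cons addrCA addrC cosD.
  rewrite addrAC cosDpihalf; rewrite /V; ring.
rewrite ExD; [|by apply: bmM; [exact: bm_cos|apply: bmM => //; exact: bm_cos]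
  |by apply: bmM; [exact: bm_cos|apply: bmM => //; exact: bm_sin]].
rewrite !IH; [|exact: bm_sin|exact: bm_cos].
by rewrite cZ sZ big_cons -/v; ring.
Qed.

End CosineSums.

Section BrownianCosines.
Context {d : measure_display} {T : measurableType d} {R : realType}.
Variable P : probability T R.
Variables (n : nat) (F : R -> set (set T)) (B : 'I_n -> R -> {RV P >-> R}).
Hypothesis B_brownian : forall j, standard_brownian_motion (B j).
Hypothesis B_indep : independent_processes B.
Hypothesis F_filtration : filtration F.
Hypothesis F_brownian : brownian_filtration F B.
Implicit Types (s t h phi : R) (a : 'I_n -> R).

(** The characteristic function of the Brownian increments over a time h, that is exp (- |a| ^ 2 h /
    2); only its first-order expansion in h is used. *)
Definition gauss_cos a h : R :=
  \prod_j gaussE (Num.sqrt h) (fun x => cos (a j * x)).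

Lemma measurable_increment (Y : R -> {RV P >-> R}) s t :
  measurable_fun setT (increment Y s t).
Proof. exact: measurable_funB. Qed.

Lemma Ex_cos_increments a phi s t : 0 <= s -> s < t ->
  \int[P]_w cos (phi + \sum_j a j * increment (B j) s t w) =
  cos phi * gauss_cos a (t - s).
Proof.
move=> s0 st; have t0 : 0 <= t := ltW (le_lt_trans s0 st).
have sq0 : 0 < Num.sqrt (t - s) by rewrite sqrtr_gt0 subr_gt0.
pose gen j := \bigcup_(r in [set r : R | 0 <= r])
  preimage_set_system setT (B j r : T -> R) measurable.
have law j (f : R -> R) : bounded_measurable f ->
    \int[P]_w f (increment (B j) s t w) = gaussE (Num.sqrt (t - s)) f.
  apply: gaussE_law; first exact: measurable_increment.
  by have [_ _ _] := B_brownian j; apply.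
have mB j r : 0 <= r -> measurable_fun setT (B j r : g_sigma_algebraType (gen j) -> R).
  move=> r0 _ A mA; apply: sub_sigma_algebra; exists r => //.
  by exists A.
apply: (@Ex_cos_sum _ _ _ P _ gen) => //.
- move=> j; apply: smallest_sub; first exact: sigma_algebra_measurable.
  by move=> A [r _ [D mD <-]]; exact: (measurable_funP (B j r)).
- move=> j; apply: measurable_funM => //; apply: measurable_funB; exact: mB.
- by move=> j; apply: (law j (fun x => cos (a j * x))); apply: bm_cos; exact: measurable_funM.
- move=> j; rewrite (law j (fun x => sin (a j * x))).
    by apply: gaussE_sin; rewrite gt_eqF.
  by apply: bm_sin; exact: measurable_funM.
Qed.

Lemma filtration_sub s : 0 <= s -> <<s F s >> `<=` measurable.
Proof.
move=> s0; have [sF mF _] := F_filtration.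
by rewrite (sigma_algebra_id (sF s s0)); exact: mF.
Qed.

Lemma adapted_measurable (Y : R -> {RV P >-> R}) s t : adapted F Y ->
  0 <= s -> s <= t -> measurable_fun setT (Y s : g_sigma_algebraType (F t) -> R).
Proof.
move=> aY s0 st _ A mA; apply: sub_sigma_algebra.
by have [_ _] := F_filtration; apply; [exact: s0|exact: st|apply: aY => //; exists A].
Qed.

(** The addition formula separates the past xi from the increment b, and independence factors both
    expectations. The sine part disappears: sin b is the cosine of b with phase - pi / 2, whose mean
    carries the factor cos (- pi / 2) = 0. *)
Lemma Ex_cos_step a s t (U xi : T -> R) : 0 <= s -> s < t ->
  bounded_measurable (U : g_sigma_algebraType (F s) -> R) ->
  measurable_fun setT (xi : g_sigma_algebraType (F s) -> R) ->
  \int[P]_w (U w * cos (xi w + \sum_j a j * increment (B j) s t w)) =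
  gauss_cos a (t - s) * \int[P]_w (U w * cos (xi w)).
Proof.
move=> s0 st bU mxi.
pose b w := \sum_j a j * increment (B j) s t w.
pose gen := \bigcup_(j in [set: 'I_n])
  preimage_set_system setT (increment (B j) s t) measurable.
have mb : measurable_fun setT (b : g_sigma_algebraType gen -> R).
  apply: measurable_sum => j; apply: measurable_funM => // _ A mA.
  by apply: sub_sigma_algebra; exists j => //; exists A.
have sgen : <<s gen >> `<=` measurable.
  apply: smallest_sub; first exact: sigma_algebra_measurable.
  by move=> A [j _ [D mD <-]]; exact: measurable_increment.
have sF := filtration_sub s0.
have ind : independent2 P <<s F s >> <<s gen >>.
  have [sa _ _] := F_filtration; rewrite (sigma_algebra_id (sa s s0)).
  by have [_] := F_brownian; apply => //; exact: ltW.
have bc : bounded_measurable (fun w : g_sigma_algebraType gen => cos (b w)) by exact: bm_cos.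
have bs : bounded_measurable (fun w : g_sigma_algebraType gen => sin (b w)) by exact: bm_sin.
have bUc : bounded_measurable (fun w : g_sigma_algebraType (F s) => U w * cos (xi w)).
  by apply: bmM => //; exact: bm_cos.
have bUs : bounded_measurable (fun w : g_sigma_algebraType (F s) => U w * sin (xi w)).
  by apply: bmM => //; exact: bm_sin.
transitivity (\int[P]_w (U w * cos (xi w) * cos (b w) - U w * sin (xi w) * sin (b w))).
  by apply: eq_Rintegral => w _; rewrite cosD; ring.
rewrite ExB; [|by apply: bmM; [exact: (bm_sub sF)|exact: (bm_sub sgen)]
  |by apply: bmM; [exact: (bm_sub sF)|exact: (bm_sub sgen)]].
rewrite (independent2_Ex sF sgen ind bUc bc) (independent2_Ex sF sgen ind bUs bs).
have := Ex_cos_increments a 0 s0 st; rewrite cos0 mul1r.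
under eq_Rintegral do rewrite add0r -/(b _).
move=> ->.
have := Ex_cos_increments a (- (pi / 2)) s0 st.
under eq_Rintegral do rewrite addrC -/(b _) cosBpihalf.
by move=> ->; rewrite cosN cos_pihalf mul0r mulr0 subr0 mulrC.
Qed.

End BrownianCosines.

(** * The discretised wave *)

Lemma cos_lipschitz (R : realType) (x y : R) : `|cos x - cos y| <= `|x - y|.
Proof.
wlog xy : x y / y <= x.
  move=> wl; case/orP: (le_total y x) => /wl //.
  by rewrite distrC [X in _ <= X -> _]distrC.
rewrite [leRHS]ger0_norm ?subr_ge0// -[leRHS]mul1r.
have -> : cos x - cos y = cos (y + (x - y)) - cos y by congr (cos _ - _); ring.
apply: (@normr_le_derive _ (fun u => cos (y + u) - cos y) (fun u => - sin (y + u))).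
- by move=> u; apply: is_derive_eq; rewrite /GRing.scale/=; ring.
- by rewrite addr0 subrr.
- by rewrite subr_ge0.
- by move=> v _; rewrite normrN ler_norml sin_geN1 sin_le1.
Qed.

Section StoppedSums.
Context {R : realType}.
Variables (g : nat -> R) (K : R).
Hypothesis g_nd : forall i, g i <= g i.+1.
Notation kap i := ((g i <= K)%R%:R : R).

Lemma nondecreasing_leq (i j : nat) : (i <= j)%N -> g i <= g j.
Proof. by apply: (homo_leq (fun=> lexx _) (fun y x z => @le_trans _ _ y x z)). Qed.

(** As g is nondecreasing, the weights are 1 up to some index and 0 afterwards, so the sum
    telescopes up to k. The test is made at the left end of the step, hence g itself may already
    exceed K at k. *)
Lemma stopped_telescope (w : nat -> R) N : exists2 k : nat, (k <= N)%N /\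
    (k = N \/ K < g k) & \sum_(i < N) kap i * (w i.+1 - w i) = w k - w 0%N.
Proof.
elim: N => [|N [k [kN kK] IHN]].
  by exists 0%N; [split => //; left|rewrite big_ord0 subrr].
rewrite big_ord_recr/= IHN; have [gK|gK] := lerP (g N) K.
  exists N.+1; first by split => //; left.
  case: kK => [->|]; first by rewrite mul1r; ring.
  by rewrite ltNge (le_trans (nondecreasing_leq kN) gK).
exists k; last by rewrite mul0r addr0.
split; first exact: leqW.
by right; case: kK => [->|].
Qed.

Lemma stopped_telescope_le (w : nat -> R) (M : R) N :
  (forall i, (i <= N)%N -> `|w i| <= M) ->
  `|\sum_(i < N) kap i * (w i.+1 - w i)| <= 2 * M.
Proof.
move=> wM; have [k [kN _] ->] := stopped_telescope w N.
by rewrite (le_trans (ler_normB _ _))// mulr2n mulrDl mul1r lerD ?wM.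
Qed.

Lemma stopped_telescope_id (w : nat -> R) N : g N <= K ->
  \sum_(i < N) kap i * (w i.+1 - w i) = w N - w 0%N.
Proof.
move=> gK; have [k [kN [->//|Kg]] _] := stopped_telescope w N.
by have := lt_le_trans Kg (le_trans (nondecreasing_leq kN) gK); rewrite ltxx.
Qed.

(** The steps ending with g at most K contribute at most c K in total. The step that crosses K still
    has weight 1 and may be arbitrarily long; it is controlled by M alone. *)
Lemma stopped_sum_le (x : nat -> R) (c M : R) N : g 0%N = 0 -> 0 <= K ->
  0 <= c -> 0 <= M ->
  (forall i, (i < N)%N -> x i <= M /\ x i <= c * (g i.+1 - g i)) ->
  \sum_(i < N) kap i * x i <= c * K + M.
Proof.
move=> g0 K0 c0 M0 xle.
have /(_ N (leqnn N)): forall m, (m <= N)%N ->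
    \sum_(i < m) kap i * x i <= if g m <= K then c * g m else c * K + M.
  elim=> [|m IHm] mN; first by rewrite big_ord0 g0 K0 mulr0.
  rewrite big_ord_recr/=; have := IHm (ltnW mN); have [xM xc] := xle m mN.
  have [gK|gK] := lerP (g m) K.
    rewrite mul1r => IH; have [gK'|gK'] := lerP (g m.+1) K; first by lra.
    by have := ler_wpM2l c0 gK; lra.
  by rewrite mul0r addr0 (lt_geF (lt_le_trans gK (g_nd m))).
by have [gK|_] := lerP (g N) K => //; have := ler_wpM2l c0 gK; lra.
Qed.

End StoppedSums.

Section Discretisation.
Context {d : measure_display} {T : measurableType d} {R : realType}.
Variable P : probability T R.
Variables (n : nat) (F : R -> set (set T)) (B X : 'I_n -> R -> {RV P >-> R}).
Hypothesis B_brownian : forall j, standard_brownian_motion (B j).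
Hypothesis B_indep : independent_processes B.
Hypothesis F_filtration : filtration F.
Hypothesis F_brownian : brownian_filtration F B.
Hypothesis X_adapted : forall j, adapted F (X j).
Variable t : R.
Hypothesis t_gt0 : 0 < t.

Definition grid (N i : nat) : R := i%:R * (t / N%:R).

(** Over the step this is the increment of X - B, almost surely the integral of the drift. In this
    form it is adapted and defined for every outcome. *)
Definition drift_step N (j : 'I_n) i w : R :=
  increment (X j) (grid N i) (grid N i.+1) w
  - increment (B j) (grid N i) (grid N i.+1) w.

Definition drift_variation N i w : R := \sum_(l < i) \sum_j `|drift_step N j l w|.

(* Depends only on the past of [grid N i], hence may multiply the next Brownian
   increment. *)
Definition alive N (K : R) i w : R := (drift_variation N i w <= K)%R%:R.

Definition phase (a : 'I_n -> R) (phi s : R) w : R := phi + \sum_j a j * X j s w.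

Definition drift_phase (a : 'I_n -> R) N i w : R := \sum_j a j * drift_step N j i w.

Lemma grid_ge0 N i : 0 <= grid N i.
Proof. by rewrite mulr_ge0// divr_ge0// ltW. Qed.

Lemma gridS N i : grid N i.+1 - grid N i = t / N%:R.
Proof. by rewrite /grid -natr1; ring. Qed.

Lemma grid_le N i j : (i <= j)%N -> grid N i <= grid N j.
Proof. by move=> ij; rewrite ler_wpM2r ?ler_nat// divr_ge0// ltW. Qed.

Lemma drift_variation_le N w i : drift_variation N i w <= drift_variation N i.+1 w.
Proof. by rewrite /drift_variation big_ord_recr/= lerDl sumr_ge0. Qed.

Lemma alive_ge0 N K i w : 0 <= alive N K i w <= 1.
Proof. by rewrite /alive; case: (drift_variation N i w <= K); rewrite ?lexx ?ler01. Qed.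

Lemma measurable_drift_step N j i u : grid N i.+1 <= u ->
  measurable_fun setT (drift_step N j i : g_sigma_algebraType (F u) -> R).
Proof.
move=> iu; have iu' : grid N i <= u by rewrite (le_trans (grid_le N (leqnSn i))).
have [aB _] := F_brownian.
by apply: measurable_funB; apply: measurable_funB;
  apply: adapted_measurable => //; exact: grid_ge0.
Qed.

Lemma bm_alive N K i :
  bounded_measurable (alive N K i : g_sigma_algebraType (F (grid N i)) -> R).
Proof.
pose v : g_sigma_algebraType (F (grid N i)) -> R := drift_variation N i.
have mv : measurable_fun setT v.
  apply: measurable_sum => l; apply: measurable_sum => j.
  apply: measurableT_comp => //; apply: measurable_drift_step.
  exact: grid_le.
rewrite (_ : alive N K i = \1_(v @^-1` `]-oo, K])).
  apply: bm_indic; rewrite -[X in measurable X]setTI; exact: mv.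
apply/funext => w; rewrite indicE /alive; congr (nat_of_bool _)%:R.
apply/idP/idP => [vK|/set_mem/=]; last by rewrite in_itv.
by apply/mem_set; rewrite /= in_itv.
Qed.

Lemma measurable_phase a phi s : measurable_fun setT (phase a phi s).
Proof.
by apply: measurable_funD => //; apply: measurable_sum => j; apply: measurable_funM.
Qed.

Lemma measurable_drift_phase a N i : measurable_fun setT (drift_phase a N i).
Proof.
apply: measurable_sum => j; apply: measurable_funM => //.
by apply: measurable_funB; exact: measurable_increment.
Qed.

Lemma bm_alive_full N K i : bounded_measurable (alive N K i).
Proof. exact: (bm_sub (filtration_sub F_filtration (grid_ge0 N i)) (bm_alive N K i)). Qed.

(** Removing the drift from the phase at the right end leaves the phase at the left end plus a
    Brownian increment, so [Ex_cos_step] applies with [alive] as the past factor. *)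
Lemma Ex_alive_cos a phi N K i : (0 < N)%N ->
  \int[P]_w (alive N K i w * (cos (phase a phi (grid N i.+1) w - drift_phase a N i w)
    - gauss_cos a (t / N%:R) * cos (phase a phi (grid N i) w))) = 0.
Proof.
move=> N0; have h0 : grid N i < grid N i.+1.
  by rewrite -subr_gt0 gridS divr_gt0// ltr0n.
have := @Ex_cos_step _ _ _ P _ F B B_brownian B_indep F_filtration F_brownian a
  _ _ (alive N K i) (phase a phi (grid N i)) (grid_ge0 N i) h0 (bm_alive N K i).
rewrite gridS => step.
have mph : measurable_fun setT
    (phase a phi (grid N i) : g_sigma_algebraType (F (grid N i)) -> R).
  apply: measurable_funD => //; apply: measurable_sum => j.
  by apply: measurable_funM => //; apply: adapted_measurable => //; exact: grid_ge0.
have bk := bm_alive_full N K i.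
have bc := bm_cos (measurable_phase a phi (grid N i)).
transitivity (\int[P]_w (alive N K i w * cos (phase a phi (grid N i) w +
    \sum_j a j * increment (B j) (grid N i) (grid N i.+1) w) -
    gauss_cos a (t / N%:R) * (alive N K i w * cos (phase a phi (grid N i) w)))).
  apply: eq_Rintegral => w _; rewrite mulrBr mulrCA; congr (_ * cos _ - _).
  rewrite /phase /drift_phase -!addrA; congr (_ + _).
  rewrite -sumrB -big_split/=; apply: eq_bigr => j _.
  by rewrite /drift_step /increment; ring.
rewrite ExB; [|apply: bmM => //|by apply: bmZ; exact: bmM].
  by rewrite step// ExZ ?subrr//; exact: bmM.
apply: bm_cos; apply: measurable_funD; first exact: measurable_phase.
by apply: measurable_sum => j; apply: measurable_funM => //; exact: measurable_increment.
Qed.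

(* The increment of [wave] over the step, divided by e^(gam s) at the left end s,
   minus cos (phase - drift_phase) - gauss_cos a h * cos phase, which has mean 0
   by [Ex_alive_cos]. *)
Definition remainder a phi gam N i w : R :=
  (expR (gam * (t / N%:R)) - 1) * cos (phase a phi (grid N i.+1) w)
  - (1 - gauss_cos a (t / N%:R)) * cos (phase a phi (grid N i) w)
  + (cos (phase a phi (grid N i.+1) w)
     - cos (phase a phi (grid N i.+1) w - drift_phase a N i w)).

Definition wave a phi gam s w : R := expR (gam * s) * cos (phase a phi s w).

Lemma bm_wave a phi gam s : bounded_measurable (wave a phi gam s).
Proof. by apply: bmZ; apply: bm_cos; exact: measurable_phase. Qed.

Lemma bm_remainder a phi gam N i : bounded_measurable (remainder a phi gam N i).
Proof.
have mp s := measurable_phase a phi s.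
apply: bmD; apply: bmB; try apply: bmZ; apply: bm_cos => //.
by apply: measurable_funB => //; exact: measurable_drift_phase.
Qed.

Lemma Ex_alive_wave a phi gam N K : (0 < N)%N ->
  \int[P]_w (\sum_(i < N) alive N K i w *
      (wave a phi gam (grid N i.+1) w - wave a phi gam (grid N i) w)) =
  \int[P]_w (\sum_(i < N) alive N K i w *
      (expR (gam * grid N i) * remainder a phi gam N i w)).
Proof.
move=> N0; have bk := bm_alive_full N K.
have br := bm_remainder a phi gam N; have bw := bm_wave a phi gam.
rewrite !Ex_sum; first last.
- by move=> i _; apply: bmM => //; exact: bmB.
- by move=> i _; apply: bmM => //; exact: bmZ.
apply: eq_bigr => i _; apply/eqP; rewrite -subr_eq0 -ExB; first last.
- by apply: bmM => //; exact: bmZ.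
- by apply: bmM => //; exact: bmB.
have := Ex_alive_cos a phi K i N0 => /(congr1 ( *%R (expR (gam * grid N i)))).
rewrite mulr0 -ExZ => [<-|]; last first.
  apply: bmM => //; apply: bmB; last by apply: bmZ; exact: bm_cos (measurable_phase _ _ _).
  apply: bm_cos; apply: measurable_funB; first exact: measurable_phase.
  exact: measurable_drift_phase.
apply/eqP; apply: eq_Rintegral => w _; rewrite /wave /remainder.
have -> : gam * grid N i.+1 = gam * grid N i + gam * (t / N%:R).
  by rewrite -(gridS N i); ring.
by rewrite expRD; ring.
Qed.

Lemma drift_phase_le a c N i w : (forall j, `|a j| <= c) ->
  `|drift_phase a N i w| <= c * (drift_variation N i.+1 w - drift_variation N i w).
Proof.
move=> ac; rewrite /drift_variation big_ord_recr/= addrAC subrr add0r.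
rewrite (le_trans (ler_norm_sum _ _ _))// mulr_sumr ler_sum// => j _.
by rewrite normrM ler_wpM2r.
Qed.

(* Since 1 - gauss_cos a h is of order |a|^2 h, this bounds the Fourier transform
   of the occupation measure of X by O(1 / |a|). *)
Lemma Ex_alive_phase a phi c N K : (0 < N)%N -> 0 <= K -> 0 <= c ->
  (forall j, `|a j| <= c) ->
  `|(1 - gauss_cos a (t / N%:R)) *
    \int[P]_w (\sum_(i < N) alive N K i w * cos (phase a phi (grid N i) w))|
  <= c * K + 4.
Proof.
move=> N0 K0 c0 ac; have bk := bm_alive_full N K.
have mp s := measurable_phase a phi s; have bw := bm_wave a phi 0.
pose e i w := cos (phase a phi (grid N i.+1) w)
     - cos (phase a phi (grid N i.+1) w - drift_phase a N i w).
have be i : bounded_measurable (e i).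
  apply: bmB; apply: bm_cos => //.
  by apply: measurable_funB => //; exact: measurable_drift_phase.
(* With growth 0 the wave is the bare cosine. Its stopped telescoping sum is at most 2 in modulus
   and the stopped drift jumps at most c K + 2, whence the constant 4. *)
have := Ex_alive_wave a phi 0 K N0.
have -> : \int[P]_w (\sum_(i < N) alive N K i w *
      (expR (0 * grid N i) * remainder a phi 0 N i w)) =
    \int[P]_w (\sum_(i < N) alive N K i w * e i w) -
    (1 - gauss_cos a (t / N%:R)) *
    \int[P]_w (\sum_(i < N) alive N K i w * cos (phase a phi (grid N i) w)).
  rewrite -ExZ -?ExB; first last.
  - by apply: bm_sum => i _; apply: bmM => //; exact: bm_cos.
  - by apply: bmZ; apply: bm_sum => i _; apply: bmM => //; exact: bm_cos.
  - by apply: bm_sum => i _; exact: bmM.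
  apply: eq_Rintegral => w _; rewrite mulr_sumr -sumrB; apply: eq_bigr => i _.
  by rewrite /remainder !mul0r expR0 subrr -/(e i w); ring.
set I1 := \int[P]_w _; set I2 := \int[P]_w _; set I3 := _ * _ => I123.
have -> : I3 = I2 - I1 by rewrite I123; ring.
have I2le : `|I2| <= c * K + 2.
  apply: Ex_norm_le => [|w]; first by apply: bm_sum => i _; exact: bmM.
  rewrite (le_trans (ler_norm_sum _ _ _))//.
  rewrite (eq_bigr (fun i : 'I_N => alive N K i w * `|e i w|)); last first.
    by move=> i _; rewrite normrM ger0_norm//; have /andP[] := alive_ge0 N K i w.
  apply: (@stopped_sum_le _ (drift_variation N ^~ w) K (drift_variation_le N w)
    (fun i => `|e i w|)) => //.
    by rewrite /drift_variation big_ord0.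
  move=> i _; split.
    rewrite (le_trans (ler_normB _ _))// -[leRHS]/(1 + 1).
    by apply: lerD; rewrite ler_norml cos_geN1 cos_le1.
  apply: le_trans (drift_phase_le N i w ac).
  by rewrite (le_trans (cos_lipschitz _ _))// subKr.
have I1le : `|I1| <= 2.
  apply: Ex_norm_le => [|w].
    by apply: bm_sum => i _; apply: bmM => //; exact: bmB.
  rewrite -[leRHS]mulr1.
  apply: (@stopped_telescope_le _ _ _ (drift_variation_le N w)
    (fun i => wave a phi 0 (grid N i) w)).
  by move=> i _; rewrite /wave mul0r expR0 mul1r ler_norml cos_geN1 cos_le1.
by rewrite (le_trans (ler_normB _ _))//; lra.
Qed.

End Discretisation.

(** * Expansions of order one in the step *)

Section Rates.
Context {R : realType}.
Implicit Types (f g : R -> R) (p q : R).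

(** The sign makes p a rate of decay; the remainder C h ^ 2 is negligible even when summed over the
    t / h steps of a grid. *)
Definition has_rate f p := exists C e : R, [/\ 0 <= C, 0 < e &
  forall h, 0 < h -> h < e -> `|f h - (1 - p * h)| <= C * h ^+ 2].

Lemma has_rateM f g p q : has_rate f p -> has_rate g q ->
  has_rate (fun h => f h * g h) (p + q).
Proof.
move=> [C [e [C0 e0 fC]]] [D [e' [D0 e'0 gD]]].
exists (C * (1 + `|q| + D) + (1 + `|p|) * D + `|p * q|), (Num.min 1 (Num.min e e')).
split; [|by rewrite !lt_min ltr01 e0|].
  by rewrite !addr_ge0// mulr_ge0// !addr_ge0.
move=> h h0; rewrite !lt_min => /and3P[h1 he he'].
have hf := fC h h0 he; have hg := gD h h0 he'.
have h2 : 0 <= h ^+ 2 by exact: sqr_ge0.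
have h21 : h ^+ 2 <= 1 by rewrite expr_le1// ltW.
have gle : `|g h| <= 1 + `|q| + D.
  have -> : g h = (g h - (1 - q * h)) + (1 - q * h) by ring.
  rewrite (le_trans (ler_normD _ _))//.
  have : `|1 - q * h| <= 1 + `|q|.
    rewrite (le_trans (ler_normB _ _))// normr1 lerD2l normrM (gtr0_norm h0).
    by rewrite ler_piMr// ltW.
  have : D * h ^+ 2 <= D by rewrite ler_piMr.
  lra.
have ple : `|1 - p * h| <= 1 + `|p|.
  rewrite (le_trans (ler_normB _ _))// normr1 lerD2l normrM (gtr0_norm h0).
  by rewrite ler_piMr// ltW.
have -> : f h * g h - (1 - (p + q) * h) = (f h - (1 - p * h)) * g h +
    (1 - p * h) * (g h - (1 - q * h)) + p * q * h ^+ 2 by ring.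
have l1 : `|(f h - (1 - p * h)) * g h| <= C * h ^+ 2 * (1 + `|q| + D).
  by rewrite normrM ler_pM.
have l2 : `|(1 - p * h) * (g h - (1 - q * h))| <= (1 + `|p|) * (D * h ^+ 2).
  by rewrite normrM ler_pM.
have l3 : `|p * q * h ^+ 2| = `|p * q| * h ^+ 2.
  by rewrite normrM [`|h ^+ 2|]ger0_norm.
apply: le_trans (ler_normD _ _) _; rewrite l3.
have := ler_normD ((f h - (1 - p * h)) * g h) ((1 - p * h) * (g h - (1 - q * h))).
lra.
Qed.

Lemma has_rate_prod (I : Type) (s : seq I) (f : I -> R -> R) (p : I -> R) :
  (forall i, has_rate (f i) (p i)) ->
  has_rate (fun h => \prod_(i <- s) f i h) (\sum_(i <- s) p i).
Proof.
move=> fp; elim: s => [|i s IHs].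
  exists 0, 1; split => // h _ _.
  by rewrite !big_nil mul0r subr0 subrr normr0 mul0r.
have [C [e [C0 e0 H]]] := has_rateM (fp i) IHs.
by exists C, e; split => // h h0 he; rewrite !big_cons; exact: H.
Qed.

(** From 1 - x <= exp (- x): the error times 1 - x is at most x ^ 2, and 1 - x >= 1 / 2. *)
Lemma expR_taylor2 (x : R) : `|x| <= 1 / 2 -> `|expR x - 1 - x| <= 2 * x ^+ 2.
Proof.
rewrite ler_norml => /andP[x1 x2].
have e1 := expR_ge1Dx x; have e2 := expR_ge1Dx (- x).
have e0 := expR_gt0 x.
have : expR x * (1 - x) <= 1.
  by rewrite -[leRHS]expR0 -(subrr x) expRD ler_wpM2l// ltW.
move=> ex; rewrite ger0_norm; last lra.
have y0 : 0 <= expR x - 1 - x by lra.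
have : (expR x - 1 - x) * (1 / 2) <= (expR x - 1 - x) * (1 - x).
  by apply: ler_wpM2l => //; lra.
have -> : (expR x - 1 - x) * (1 - x) = expR x * (1 - x) - 1 + x ^+ 2 by ring.
lra.
Qed.

Lemma has_rate_expR (gam : R) : has_rate (fun h => expR (gam * h)) (- gam).
Proof.
exists (2 * gam ^+ 2), (1 / (2 * (`|gam| + 1))).
have g1 : 0 < `|gam| + 1 by rewrite ltr_wpDl.
split; [by rewrite mulr_ge0// sqr_ge0|by rewrite divr_gt0// mulr_gt0|].
move=> h h0; rewrite ltr_pdivlMr; last by rewrite mulr_gt0.
move=> hg; have := @expR_taylor2 (gam * h).
rewrite normrM (gtr0_norm h0) exprMn => /(_ _)/le_trans/(_ _).
have -> : expR (gam * h) - (1 - - gam * h) = expR (gam * h) - 1 - gam * h by ring.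
by apply; [lra|rewrite mulrA].
Qed.

Lemma has_rate_gauss_cos1 (a : R) :
  has_rate (fun h => gaussE (Num.sqrt h) (fun x => cos (a * x))) (a ^+ 2 / 2).
Proof.
(* The first summand comes from [gaussE_cos], the second is 2 (a ^ 2 / 2) ^ 2 from [expR_taylor2].
   The range of h ensures a ^ 2 h <= 1, as both require. *)
exists (1024 * expR 2 * a ^+ 4 + a ^+ 4 / 2), (1 / (a ^+ 2 + 1)).
have a2 : 0 <= a ^+ 2 := sqr_ge0 a.
have a4 : 0 <= a ^+ 4 by rewrite exprn_even_ge0.
have a1 : 0 < a ^+ 2 + 1 by lra.
split; [|by rewrite divr_gt0|].
  have e2 : 0 <= 1024 * expR (2 : R) by have := expR_gt0 (2 : R); lra.
  by have := mulr_ge0 e2 a4; lra.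
move=> h h0; rewrite ltr_pdivlMr// => ha.
have sq : Num.sqrt h ^+ 2 = h by rewrite sqr_sqrtr// ltW.
have u2 : (a * Num.sqrt h) ^+ 2 = a ^+ 2 * h by rewrite exprMn sq.
have u4 : (a * Num.sqrt h) ^+ 4 = a ^+ 4 * h ^+ 2.
  by rewrite exprMn -[X in _ * X]/(_ ^+ (2 * 2)) exprM sq.
have ah : a ^+ 2 * h <= 1 by lra.
have := @gaussE_cos R (Num.sqrt h) a; rewrite sqrtr_gt0 u2 u4 => /(_ h0).
have -> : (`|a * Num.sqrt h| <= 1) = true.
  by rewrite -(@expr_le1 _ 2)// real_normK ?num_real// u2.
move=> /(_ isT) H1.
have := @expR_taylor2 (a ^+ 2 * h / 2); rewrite ger0_norm; last first.
  by rewrite divr_ge0// mulr_ge0// ltW.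
have -> : a ^+ 2 * h / 2 <= 1 / 2 by lra.
move=> /(_ isT) H2.
set E := expR _ in H1 H2; set g := gaussE _ _ in H1 *.
have -> : g - (1 - a ^+ 2 / 2 * h) = (g - (2 - E)) - (E - 1 - a ^+ 2 * h / 2) by field.
rewrite (le_trans (ler_normB _ _))// mulrDl lerD//; first by rewrite -mulrA.
by apply: le_trans H2 _; rewrite le_eqVlt; apply/orP; left; apply/eqP; field.
Qed.

Lemma has_rate_gauss_cos n (a : 'I_n -> R) :
  has_rate (gauss_cos a) (\sum_j a j ^+ 2 / 2).
Proof.
have [C [e [C0 e0 H]]] := has_rate_prod (index_enum 'I_n)
  (fun j => has_rate_gauss_cos1 (a j)).
by exists C, e.
Qed.

End Rates.

Section Heine.
Context {R : realType}.

Lemma within_continuous_heine (f : R -> R) (t e : R) :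
  {within `[0, +oo[, continuous f} -> 0 < e ->
  exists2 del : R, 0 < del & forall u v, 0 <= u <= t -> 0 <= v <= t ->
    `|u - v| <= del -> `|f u - f v| <= e.
Proof.
move=> /subspace_continuousP cf e0.
pose Q (del u : R) := 0 <= u <= t -> forall v, 0 <= v <= t -> `|u - v| <= del ->
  `|f u - f v| <= e.
(* Compactness in its near-covering form: each x gives a radius eta, half of which is spent on the
   distance from x to u and half on that from u to v; a single del then serves all u. *)
have /compact_near_coveringP cpt : compact `[0, t] by exact: segment_compact.
have := cpt R (0^'+) Q _; case=> [|del/= del0 H].
  move=> x /=; rewrite in_itv/= => /andP[x0 xt].
  have /cf : `[0, +oo[%classic x by rewrite /= in_itv/= x0.
  have e20 : 0 < e / 2 by rewrite divr_gt0.
  move=> /cvgrPdist_le /(_ (e / 2) e20); rewrite near_withinE => -[eta/= eta0 Heta].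
  have eta20 : 0 < eta / 2 by rewrite divr_gt0.
  exists (ball x (eta / 2), [set i | i < eta / 2]) => /=.
    split; first exact: nbhsx_ballx.
    by apply: nbhs_right_lt.
  move=> [u i] /= [xu ieta] /andP[u0 ut] v /andP[v0 vt] uvi.
  have Hx z : 0 <= z -> `|x - z| < eta -> `|f x - f z| <= e / 2.
    by move=> z0 xz; apply: Heta => //; rewrite /= in_itv/= z0.
  have uu : `|f x - f u| <= e / 2 by apply: Hx => //; apply: lt_trans xu _; lra.
  have vv : `|f x - f v| <= e / 2.
    apply: Hx => //; rewrite -(subrKA u) (le_lt_trans (ler_normD _ _))//.
    by rewrite /ball/= in xu; lra.
  rewrite -(subrKA (f x)) (le_trans (ler_normD _ _))// distrC; lra.
have del20 : 0 < del / 2 by rewrite divr_gt0.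
exists (del / 2) => // u v u0t v0t uv.
have : `|0 - del / 2| < del by rewrite sub0r normrN gtr0_norm//; lra.
by move=> /H/(_ del20) Qdel; apply: (Qdel u) => //=.
Qed.


End Heine.

(** * The cotangent pairing over subsets of fixed size *)

Section DriftIdentity.
Context {R : realType}.
Variables (n : nat) (x : 'I_n -> R).

Lemma cotN (u : R) : cot (- u) = - cot u.
Proof. by rewrite /cot cosN sinN invrN mulrN. Qed.

(** The first two terms add up to - sin v / sin u, the last two to sin v / sin u. *)
Lemma cot_swap (u v : R) : sin u != 0 ->
  cos (v + u) - cot u * sin (v + u) + (cos (v - u) + cot u * sin (v - u)) = 0.
Proof.
move=> u0; by rewrite /cot !cosD !sinD cosN sinN; field.
Qed.

Definition subset_phase (phi : R) (S : {set 'I_n}) : R :=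
  phi + \sum_j (j \in S)%:R * x j.

Lemma mem_tperm_imset (S : {set 'I_n}) (j k i : 'I_n) :
  (i \in (tperm j k @: S)) = (tperm j k i \in S).
Proof. by rewrite -{1}(tpermK j k i) mem_imset//; exact: perm_inj. Qed.

Lemma subset_phase_tperm phi (S : {set 'I_n}) (j k : 'I_n) : j \in S -> k \notin S ->
  subset_phase phi (tperm j k @: S) = subset_phase phi S - (x j - x k).
Proof.
move=> jS kS; have jk : j != k by apply: contraNneq kS => <-.
rewrite /subset_phase (bigD1 j)//= (bigD1 k) 1?eq_sym//=.
rewrite [X in _ = _ + X - _](bigD1 j)//= [X in _ = _ + (_ + X) - _](bigD1 k) 1?eq_sym//=.
rewrite !mem_tperm_imset tpermL tpermR jS (negbTE kS).
under eq_bigr => i /andP[ij ik] do rewrite mem_tperm_imset tpermD 1?eq_sym//.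
by rewrite /=; ring.
Qed.

Hypothesis x_sep : forall j k : 'I_n, j != k -> sin ((x j - x k) / 2) != 0.
Let c j k := cot ((x j - x k) / 2).

Lemma drift_identity (phi lam : R) (m : nat) :
  \sum_(S : {set 'I_n} | #|S| == m)
    (lam * (m%:R * (n - m)%:R) * cos (subset_phase phi S)
     - (\sum_j (j \in S)%:R * (lam * \sum_(k < n | k != j) cot ((x j - x k) / 2)))
       * sin (subset_phase phi S)) = 0.
Proof.
have cA j k : c k j = - c j k.
  by rewrite /c -cotN; congr cot; field.
have cjj j : c j j = 0 by rewrite /c subrr mul0r /cot sin0 invr0 mulr0.
pose W (S : {set 'I_n}) (j k : 'I_n) : R := (j \in S)%:R * (k \notin S)%:R.
pose D (S : {set 'I_n}) j k := W S j k *
  (cos (subset_phase phi S) - c j k * sin (subset_phase phi S)).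
have driftE (S : {set 'I_n}) :
    \sum_j (j \in S)%:R * (lam * \sum_(k < n | k != j) cot ((x j - x k) / 2)) =
    lam * \sum_j \sum_k W S j k * c j k.
  (* Pairs with both indices in S cancel by antisymmetry of the cotangent, so only pairs with
     exactly one index in S remain. Their number is m (n - m), which lets the cosine term be shared
     out, one copy per pair. *)
  have inner : \sum_j \sum_k (j \in S)%:R * (k \in S)%:R * c j k = 0.
    apply/eqP; rewrite -[_ == 0](mulrn_eq0 _ 2)/= mulr2n {2}exchange_big/=.
    rewrite -big_split/= big1// => j _; rewrite -big_split/= big1// => k _.
    by rewrite cA; ring.
  rewrite -[RHS]addr0 -[X in _ = _ + X](mulr0 lam) -[X in _ = _ + _ * X]inner.
  rewrite -mulrDr -big_split/= mulr_sumr; apply: eq_bigr => j _.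
  rewrite mulrCA -big_split/=; congr (_ * _).
  rewrite mulr_sumr big_mkcond/=; apply: eq_bigr => k _.
  have [->|kj] := eqVneq k j; first by rewrite cjj; ring.
  by rewrite /W -/(c j k); case: (k \in S) => /=; ring.
have countE (S : {set 'I_n}) : #|S| == m -> m%:R * (n - m)%:R = \sum_j \sum_k W S j k.
  move=> /eqP Sm; transitivity (\sum_j (j \in S)%:R * \sum_k (k \notin S)%:R : R).
    rewrite -mulr_suml -!natr_sum; congr (_%:R * _%:R).
      rewrite -Sm -sum1_card big_mkcond/=; apply: eq_bigr => j _.
      by case: (j \in S).
    have <- : #|~: S|%SET = (n - m)%N by rewrite cardsCs finset.setCK card_ord Sm.
    rewrite -sum1_card big_mkcond/=.
    by apply: eq_bigr => k _; rewrite inE; case: (k \in S).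
  by apply: eq_bigr => j _; rewrite mulr_sumr.
have -> : \sum_(S : {set 'I_n} | #|S| == m)
    (lam * (m%:R * (n - m)%:R) * cos (subset_phase phi S)
     - (\sum_j (j \in S)%:R * (lam * \sum_(k < n | k != j) cot ((x j - x k) / 2)))
       * sin (subset_phase phi S)) =
   lam * \sum_j \sum_k \sum_(S : {set 'I_n} | #|S| == m) D S j k.
  under [in RHS]eq_bigr do rewrite exchange_big/=.
  rewrite exchange_big/= mulr_sumr; apply: eq_bigr => S Sm.
  rewrite driftE (countE S Sm) -!mulrA -mulrBr !mulr_suml -sumrB; congr (_ * _).
  apply: eq_bigr => j _; rewrite !mulr_suml -sumrB; apply: eq_bigr => k _.
  by rewrite /D; ring.
pose U j k := \sum_(S : {set 'I_n} | #|S| == m) D S j k.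
(* Antisymmetry of U suffices. In U k j the sets are reindexed by the transposition of j and k,
   which preserves the size and moves k into the set in place of j. *)
suff UA j k : U j k + U k j = 0.
  have : \sum_j \sum_k U j k = 0.
    apply/eqP; rewrite -[_ == 0](mulrn_eq0 _ 2)/= mulr2n {2}exchange_big/=.
    by rewrite -big_split/= big1// => j _; rewrite -big_split/= big1.
  by rewrite /U => ->; rewrite mulr0.
have [->|jk] := eqVneq j k.
  by rewrite /U !big1 ?addr0// => S _; rewrite /D /W; case: (k \in S) => /=; ring.
have -> : U k j = \sum_(S : {set 'I_n} | #|S| == m) D (tperm j k @: S) k j.
  rewrite /U (reindex_inj (h := fun S : {set 'I_n} => tperm j k @: S))/=.
    by apply: eq_bigl => S; rewrite card_imset//; exact: perm_inj.
  by apply: imset_inj; exact: perm_inj.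
rewrite /U -big_split/= big1// => S _; rewrite /D.
rewrite /W !mem_tperm_imset tpermL tpermR.
have [jS|jS] := boolP (j \in S); last by rewrite /=; ring.
have [kS|kS] := boolP (k \in S); first by rewrite /=; ring.
rewrite subset_phase_tperm// !mul1r (cA j k) mulNr opprK.
(* Here v is midway between the phases of S and of the swapped set, and u is half their
   difference. *)
have := @cot_swap ((x j - x k) / 2) (subset_phase phi S - (x j - x k) / 2) (x_sep jk).
rewrite -/(c j k) subrK.
by have -> : subset_phase phi S - (x j - x k) / 2 - (x j - x k) / 2 =
  subset_phase phi S - (x j - x k) by field.
Qed.

End DriftIdentity.

(** * Collisions have Lebesgue measure zero *)

Section AlmostSureBound.
Context {d : measure_display} {T : measurableType d} {R : realType}.
Variable P : probability T R.

Lemma Ex_markov (Q : T -> R) (a c : R) : bounded_measurable Q ->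
  (forall w, 0 <= Q w) -> 0 < a -> \int[P]_w Q w <= c ->
  (P [set w | (a <= Q w)%R] <= (c / a)%:E)%E.
Proof.
move=> bQ Q0 a0 Qc; pose A := Q @^-1` `[a, +oo[.
have mA : measurable A by rewrite -[A]setTI; apply: bQ.1.
have -> : [set w | a <= Q w] = A.
  by rewrite /A; apply/seteqP; split => w /=; rewrite in_itv/= andbT.
rewrite -[leLHS]fineK ?fin_num_measure// lee_fin -(Ex_indic P mA).
rewrite ler_pdivlMr// mulrC -ExZ; last exact: bm_indic.
apply: le_trans Qc; apply: Ex_le => //; first by apply: bmZ; exact: bm_indic.
move=> w; rewrite indicE; case: (boolP (w \in A)) => [|_]; rewrite ?mulr0//.
by rewrite mulr1 inE /A/= in_itv/= andbT.
Qed.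

(** Outside a null set, if f w >= a k then, for every L, Q L N w >= a k for all large N. Markov
    bounds the probability of that event by c L / a k, and c L can be made arbitrarily small. Only
    sets defined by Q are measured; they enclose the event on f. *)
Lemma ae_le0_double_limit (Q : nat -> nat -> T -> R) (c : nat -> R)
    (f : T -> \bar R) :
  (forall L N, bounded_measurable (Q L N)) -> (forall L N w, 0 <= Q L N w) ->
  (forall e : R, 0 < e -> exists L, c L <= e) ->
  (forall L, \forall N \near \oo, \int[P]_w Q L N w <= c L) ->
  {ae P, forall w, forall L, \forall N \near \oo, (f w <= (Q L N w)%:E)%E} ->
  {ae P, forall w, (f w <= 0)%E}.
Proof.
move=> bQ Q0 c0 Qc fQ.
pose a (k : nat) : R := k.+1%:R^-1.
have a0 k : 0 < a k by rewrite invr_gt0 ltr0n.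
(* These sets increase with M; their union G k L is the event that Q L N >= a k for all large N. *)
pose A k L M := \bigcap_(N in [set N | (M <= N)%N]) [set w | a k <= Q L N w].
have mQ k L N : measurable [set w | a k <= Q L N w].
  rewrite (_ : [set _ | _] = Q L N @^-1` `[a k, +oo[); last first.
    by apply/seteqP; split => w /=; rewrite in_itv/= andbT.
  by rewrite -[X in measurable X]setTI; apply: (bQ L N).1.
have mA k L M : measurable (A k L M).
  by apply: bigcap_measurable; [exists M => /=|move=> N _; exact: mQ].
have PA k L M : (P (A k L M) <= (c L / a k)%:E)%E.
  have [N0 _ HN] := Qc L.
  have N0N : (N0 <= maxn N0 M)%N by exact: leq_maxl.
  apply: le_trans (Ex_markov (bQ L (maxn N0 M)) (Q0 L (maxn N0 M)) (a0 k) (HN _ N0N)).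
  apply: le_measure; [by rewrite inE; exact: mA|by rewrite inE; exact: mQ|].
  by move=> w /(_ (maxn N0 M)); apply => /=; exact: leq_maxr.
pose G k L := \bigcup_M A k L M.
have mG k L : measurable (G k L) by exact: bigcup_measurable.
have PG k L : (P (G k L) <= (c L / a k)%:E)%E.
  have ndA : nondecreasing_seq (A k L).
    move=> M M' MM'; apply/subsetPset => w Aw N /= M'N.
    by apply: Aw => /=; exact: leq_trans MM' M'N.
  have cv := nondecreasing_cvg_mu (mA k L) (mG k L) ndA.
  have {}cv := cv R P.
  rewrite -(cvg_lim _ cv)//; apply: lime_le; first exact: cvgP cv.
  by near=> M; exact: PA.
pose Z k := \bigcap_L G k L.
have mZ k : measurable (Z k) by exact: bigcap_measurableType.
have PZ k : P (Z k) = 0%E.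
  apply/eqP; rewrite eq_le measure_ge0 andbT; apply/lee_addgt0Pr => e e0.
  rewrite add0e; have [L cL] := c0 (e * a k) (mulr_gt0 e0 (a0 k)).
  apply: (@le_trans _ _ (P (G k L))).
    apply: le_measure; [by rewrite inE; exact: mZ|by rewrite inE; exact: mG|].
    by move=> w /(_ L); exact.
  by apply: le_trans (PG k L) _; rewrite lee_fin ler_pdivrMr.
have aeZ : {ae P, forall w, forall k, ~ Z k w}.
  apply: ae_foralln => k; exists (Z k); split => //; first exact: PZ.
  by move=> w /= /contrapT.
apply: filterS2 fQ aeZ => w fw Zw; rewrite leNgt; apply/negP => fw0.
have [k ak] : exists k, ((a k)%:E <= f w)%E.
  case: (f w) fw0 => [r| |//]; last by exists 0%N; rewrite leey.
  rewrite lte_fin => r0; exists (Num.trunc r^-1); rewrite lee_fin.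
  rewrite -[leRHS]invrK lef_pV2 ?posrE ?invr_gt0 ?ltr0n//; apply: ltW.
  exact: truncnS_gt.
apply: (Zw k) => L _; have [N0 _ HN] := fw L.
by exists N0 => // N N0N; have := le_trans ak (HN N N0N); rewrite lee_fin.
Unshelve. all: by end_near. Qed.

End AlmostSureBound.

Section FejerKernel.
Context {R : realType}.
Implicit Types y u v : R.

(* |L^-1 \sum_(l < L) exp (i l L y)|^2: the distinct frequencies (l - l') L in
   its expansion all have modulus at least L. *)
Definition fejer (L : nat) y : R :=
  ((\sum_(l < L) cos ((l * L)%:R * y)) ^+ 2 + (\sum_(l < L) sin ((l * L)%:R * y)) ^+ 2)
  / (L ^ 2)%:R.

Lemma fejerE L y : fejer L y =
  (L ^ 2)%:R^-1 * \sum_(l < L) \sum_(l' < L) cos (((l * L)%:R - (l' * L)%:R) * y).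
Proof.
rewrite /fejer mulrC; congr (_ * _).
rewrite !expr2 !mulr_suml -big_split/=; apply: eq_bigr => l _.
rewrite !mulr_sumr -big_split/=; apply: eq_bigr => l' _.
by rewrite mulrBl cosB.
Qed.

Lemma fejer_ge0 L y : 0 <= fejer L y.
Proof. by rewrite divr_ge0// addr_ge0// sqr_ge0. Qed.

Lemma cos_sin_natmul y : sin (y / 2) = 0 ->
  forall k : nat, cos (k%:R * y) = 1 /\ sin (k%:R * y) = 0.
Proof.
move=> s0; have yE : y = y / 2 + y / 2 by field.
have c1 : cos y = 1.
  by rewrite yE cosD s0 mulr0 subr0 -expr2 cos2sin2 s0 expr0n subr0.
have s1 : sin y = 0 by rewrite yE sinD s0 mul0r mulr0 addr0.
elim=> [|k [ck sk]]; first by rewrite mul0r cos0 sin0.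
by rewrite -natr1 mulrDl mul1r cosD sinD ck sk c1 s1; split; ring.
Qed.

(** The frequencies are integers, so every exponential equals 1 on the multiples of 2 pi: the kernel
    detects all meetings on the circle, not only y = 0. *)
Lemma fejer_eq1 L y : (0 < L)%N -> sin (y / 2) = 0 -> fejer L y = 1.
Proof.
move=> L0 s0; rewrite /fejer.
under eq_bigr do rewrite (cos_sin_natmul s0 _).1.
under [X in (_ + X ^+ 2) / _]eq_bigr do rewrite (cos_sin_natmul s0 _).2.
rewrite sumr_const card_ord big1// expr0n addr0 -natrX divff//.
by rewrite pnatr_eq0 expn_eq0 negb_and -lt0n L0.
Qed.

(** The kernel is an average of cosines whose frequencies are at most L ^ 2 in modulus. *)
Lemma fejer_lipschitz L u v : `|fejer L u - fejer L v| <= (L ^ 2)%:R * `|u - v|.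
Proof.
have [->|L0] := posnP L.
  by rewrite !fejerE !big_ord0 !mulr0 subrr normr0 mul0r.
have L2 : 0 < (L ^ 2)%:R :> R by rewrite ltr0n expn_gt0 L0.
rewrite !fejerE -mulrBr normrM gtr0_norm ?invr_gt0// ler_pdivrMl//.
rewrite -sumrB (le_trans (ler_norm_sum _ _ _))//.
apply: (@le_trans _ _ (\sum_(l < L) \sum_(l' < L) (L ^ 2)%:R * `|u - v|)); last first.
  by rewrite !sumr_const !card_ord -mulrnA mulnn -[X in X <= _]mulr_natl.
apply: ler_sum => l _; rewrite -sumrB (le_trans (ler_norm_sum _ _ _))//.
apply: ler_sum => l' _; rewrite (le_trans (cos_lipschitz _ _))// -mulrBr normrM.
rewrite ler_wpM2r//.
have ub (i : 'I_L) : (0 <= (i * L)%:R :> R) && ((i * L)%:R <= (L ^ 2)%:R :> R).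
  by rewrite ler0n ler_nat -mulnn leq_mul2r ltnW ?orbT.
have /andP[l1 l2] := ub l; have /andP[l3 l4] := ub l'.
by rewrite ler_norml; lra.
Qed.

End FejerKernel.

Section Collisions.
Context {R : realType}.
Notation mu := (@lebesgue_measure R).

Lemma grid_cover (t : R) (N : nat) (s : R) : 0 < t -> (0 < N)%N -> 0 <= s <= t ->
  exists i : 'I_N, grid t N i <= s <= grid t N i.+1.
Proof.
move=> t0 N0 /andP[s0 st]; have N0' : 0 < N%:R :> R by rewrite ltr0n.
have h0 : 0 < t / N%:R by rewrite divr_gt0.
(* At s = t the truncation used below would return N, which is no index of a cell; the last cell is
   taken instead. *)
rewrite /grid; have [st'|ts] := ltP s t; last first.
  have tN : t = N%:R * (t / N%:R) by field; rewrite gt_eqF.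
  have Np : (N.-1 < N)%N by rewrite prednK.
  exists (Ordinal Np); rewrite /= prednK// -tN st andbT (le_trans _ ts)//.
  by rewrite [leRHS]tN; apply: ler_wpM2r; [exact: ltW|rewrite ler_nat leq_pred].
have q0 : 0 <= s / (t / N%:R) by rewrite divr_ge0// ltW.
have /andP[k1 k2] := truncn_itv q0.
set k := Num.trunc _ in k1 k2; have kN : (k < N)%N.
  rewrite -(ltr_nat R) (le_lt_trans k1)// ltr_pdivrMr//.
  by rewrite mulrC divfK// gt_eqF.
exists (Ordinal kN) => /=; rewrite -ler_pdivlMr// k1/=.
by rewrite -ler_pdivrMr// ltW.
Qed.

(** Times at which y is a multiple of 2 pi. For y = X_j - X_k these are the times at which [cot]
    takes its default value. *)
Definition collision_times (t : R) (y : R -> R) : set R :=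
  [set s | 0 <= s <= t /\ sin (y s / 2) = 0].

Lemma measurable_collision_times (t : R) (y : R -> R) : {within `[0, +oo[, continuous y} ->
  measurable (collision_times t y).
Proof.
move=> cy; have -> : collision_times t y =
    `[0, t] `&` (fun s => sin (y s / 2)) @^-1` [set 0].
  by apply/seteqP; split => s /=; rewrite in_itv.
have cy' : {within `[0, t], continuous y}.
  apply: continuous_subspaceW cy => s /=; rewrite !in_itv/= andbT.
  by case/andP.
have my : measurable_fun `[0, t] y.
  by apply: subspace_continuous_measurable_fun => //; exact: measurable_itv.
have ms : measurable_fun `[0, t] (fun s => sin (y s / 2)).
  apply: (@measurable_comp _ _ _ _ _ _ setT) => //.
    by apply: continuous_measurable_fun; exact: continuous_sin.
  exact: measurable_funM.
by apply: ms => //; exact: measurable_itv.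
Qed.

(** On a fine grid y varies by at most 1 / (2 L ^ 2) over a cell, so the kernel varies by at most 1
    / 2. A cell that meets the collision set then has kernel value at least 1 / 2 at its left end,
    and its length is at most twice the length times that value. *)
Lemma collision_measure_le (t : R) (y : R -> R) (L : nat) : 0 < t -> (0 < L)%N ->
  {within `[0, +oo[, continuous y} ->
  \forall N \near \oo, (mu (collision_times t y) <=
    (2 * (t / N%:R * \sum_(i < N) fejer L (y (grid t N i))))%:E)%E.
Proof.
move=> t0 L0 cy.
have L2 : 0 < (L ^ 2)%:R :> R by rewrite ltr0n expn_gt0 L0.
have e0 : 0 < 1 / (2 * (L ^ 2)%:R) :> R by rewrite divr_gt0// mulr_gt0.
have [del del0 ydel] := within_continuous_heine t cy e0.
exists (Num.trunc (t / del)).+1 => // N /= NN.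
have N0 : (0 < N)%N by exact: leq_trans NN.
have N0' : 0 < N%:R :> R by rewrite ltr0n.
have h0 : 0 < t / N%:R by rewrite divr_gt0.
have hdel : t / N%:R <= del.
  rewrite ler_pdivrMr// mulrC -ler_pdivrMr//; apply: ltW.
  by apply: lt_le_trans (truncnS_gt _) _; rewrite ler_nat.
pose D (i : nat) : set R := if 1 / 2 <= fejer L (y (grid t N i))
  then `[grid t N i, grid t N i.+1]%classic else set0.
have mD i : measurable (D i) by rewrite /D; case: ifP.
have CD : collision_times t y `<=` \big[setU/set0]_(i < N) D i.
  move=> s [st s0]; have [i /andP[is_ si]] := grid_cover t0 N0 st.
  rewrite -bigcup_mkord; exists i => //=; rewrite /D.
  have /andP[s_ge0 s_le] := st.
  have gi : 0 <= grid t N i <= t.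
    by rewrite grid_ge0// (le_trans is_).
  have := ydel s (grid t N i) st gi.
  have -> : (`|s - grid t N i| <= del) = true.
    rewrite ger0_norm ?subr_ge0//; apply: le_trans hdel.
    by rewrite -(gridS t N i) lerB.
  move=> /(_ isT) ys; have := fejer_lipschitz L (y s) (y (grid t N i)).
  rewrite (fejer_eq1 L0 s0) => lip.
  have : (L ^ 2)%:R * `|y s - y (grid t N i)| <= 1 / 2.
    apply: le_trans (ler_wpM2l (ltW L2) ys) _.
    by rewrite !mul1r invfM mulrCA divff ?mulr1// gt_eqF.
  move=> lip2; have := le_trans lip lip2; rewrite ler_norml => /andP[_ f1].
  have -> : 1 / 2 <= fejer L (y (grid t N i)) by lra.
  by rewrite /= in_itv/= is_.
apply: (@le_trans _ _ (mu (\big[setU/set0]_(i < N) D i))).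
  apply: le_measure => //; rewrite inE; first exact: measurable_collision_times.
  by apply: bigsetU_measurable => i _; exact: mD.
apply: (@le_trans _ _ (\sum_(i < N) mu (D i))%E).
  have := @Boole_inequality _ _ _ mu D N; apply => i _; exact: mD.
rewrite !mulr_sumr -sumEFin; apply: lee_sum => i _; rewrite /D.
case: ifPn => fi; last first.
  rewrite measure0 lee_fin; apply: mulr_ge0 => //.
  by apply: mulr_ge0; [exact: ltW|exact: fejer_ge0].
rewrite lebesgue_measure_itv/= lte_fin -subr_gt0 gridS h0 -EFinB gridS lee_fin.
have := ler_wpM2l (ltW h0) fi; lra.
Qed.

End Collisions.

Lemma near_step (R : realType) (t e : R) : 0 < t -> 0 < e ->
  \forall N \near \oo, (0 < N)%N /\ t / N%:R < e.
Proof.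
move=> t0 e0; exists (Num.trunc (t / e)).+1 => // N /= NN.
have N0 : (0 < N)%N by exact: leq_trans NN.
split => //; rewrite ltr_pdivrMr ?ltr0n// mulrC -ltr_pdivrMr//.
by apply: lt_le_trans (truncnS_gt _) _; rewrite ler_nat.
Qed.

Section CollisionsAreNull.
Context {d : measure_display} {T : measurableType d} {R : realType}.
Variable P : probability T R.
Variables (n : nat) (F : R -> set (set T)) (B X : 'I_n -> R -> {RV P >-> R}).
Hypothesis B_brownian : forall j, standard_brownian_motion (B j).
Hypothesis B_indep : independent_processes B.
Hypothesis F_filtration : filtration F.
Hypothesis F_brownian : brownian_filtration F B.
Hypothesis X_adapted : forall j, adapted F (X j).
Hypothesis X_continuous : forall j, ae_continuous (X j).
Variable t : R.
Hypothesis t_gt0 : 0 < t.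
Hypothesis bounded_variation : {ae P, forall w, exists K : nat,
  forall N, drift_variation B X t N N w <= K%:R}.
Notation mu := (@lebesgue_measure R).

Definition pair_weight (th : R) (j k i : 'I_n) : R := th * ((i == j)%:R - (i == k)%:R).

Lemma sum_eq_natr (f : 'I_n -> R) (j : 'I_n) : \sum_i (i == j)%:R * f i = f j.
Proof.
rewrite (bigD1 j)//= eqxx mul1r big1 ?addr0// => i /negbTE ->.
by rewrite mul0r.
Qed.

Lemma phase_pair th j k s w :
  phase X (pair_weight th j k) 0 s w = th * (X j s w - X k s w).
Proof.
rewrite /phase add0r.
under eq_bigr do rewrite /pair_weight -mulrA mulrBl.
by rewrite -mulr_sumr sumrB !(sum_eq_natr (fun i => X i s w)).
Qed.

Lemma pair_weight_le th j k i : `|pair_weight th j k i| <= `|th|.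
Proof.
rewrite normrM ler_piMr//.
by case: (i == j); case: (i == k);
  rewrite ?subrr ?subr0 ?sub0r ?normrN ?normr0 ?normr1.
Qed.

Lemma pair_weight_sqr th j k : j != k ->
  \sum_i pair_weight th j k i ^+ 2 / 2 = th ^+ 2.
Proof.
move=> jk; rewrite (bigD1 j)//= (bigD1 k) 1?eq_sym//= big1 ?addr0; last first.
  by move=> i /andP[/negbTE ij /negbTE ik]; rewrite /pair_weight ij ik; ring.
by rewrite /pair_weight !eqxx [k == j]eq_sym (negbTE jk) /=; field.
Qed.

Lemma Ex_alive_pair (th K : R) (j k : 'I_n) : j != k -> th != 0 -> 0 <= K ->
  \forall N \near \oo,
    `|t / N%:R * \int[P]_w (\sum_(i < N) alive B X t N K i w *
       cos (th * (X j (grid t N i) w - X k (grid t N i) w)))|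
    <= 2 * (`|th| * K + 4) / th ^+ 2.
Proof.
move=> jk th0 K0; pose a := pair_weight th j k.
have [C [e [C0 e0 HC]]] := has_rate_gauss_cos a.
have th2 : 0 < th ^+ 2 by rewrite exprn_even_gt0.
have C1 : 0 < C + 1 by lra.
(* Below this threshold C h <= th ^ 2 / 2, so that 1 - [gauss_cos] is at least half its leading term
   th ^ 2 h and can be divided out of [Ex_alive_phase]. *)
have e1 : 0 < Num.min e (th ^+ 2 / (2 * (C + 1))).
  by rewrite lt_min e0 divr_gt0// mulr_gt0.
apply: filterS (near_step t_gt0 e1) => N [N0]; rewrite lt_min => /andP[he hC].
have h0 : 0 < t / N%:R by rewrite divr_gt0// ltr0n.
set h := t / N%:R in h0 he hC *.
have := Ex_alive_phase B_brownian B_indep F_filtration F_brownian X_adapted t_gt0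
  0 N0 K0 (normr_ge0 th) (pair_weight_le th j k).
rewrite -/h -/a.
under eq_Rintegral do under eq_bigr do rewrite phase_pair.
set I := \int[P]_w _ => HI.
have := HC h h0 he; rewrite /a pair_weight_sqr// => rho.
have hC' : C * h <= th ^+ 2 / 2.
  move: hC; rewrite ltr_pdivlMr ?mulr_gt0// => hC.
  by have := mulr_ge0 C0 (ltW h0); lra.
have rho1 : th ^+ 2 * h / 2 <= 1 - gauss_cos a h.
  have := ler_wpM2r (ltW h0) hC'; move: rho; rewrite ler_norml => /andP[_ r2].
  by rewrite /a; lra.
have ge0 : 0 <= th ^+ 2 * h / 2 by rewrite divr_ge0// mulr_ge0// ltW.
rewrite ler_pdivlMr// normrM (gtr0_norm h0).
apply: (@le_trans _ _ (2 * ((1 - gauss_cos a h) * `|I|))).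
  by have := ler_wpM2r (normr_ge0 I) rho1; lra.
rewrite ler_wpM2l//; apply: le_trans HI; rewrite normrM ler_wpM2r//.
exact: ler_norm.
Qed.

Lemma bm_fejer (L : nat) (j k : 'I_n) (s : R) :
  bounded_measurable (fun w => fejer L (X j s w - X k s w)).
Proof.
rewrite (_ : (fun w => _) = fun w => (L ^ 2)%:R^-1 * \sum_(l < L) \sum_(l' < L)
    cos (((l * L)%:R - (l' * L)%:R) * (X j s w - X k s w))).
  apply: bmZ; apply: bm_sum => l _; apply: bm_sum => l' _; apply: bm_cos.
  by apply: measurable_funM => //; exact: measurable_funB.
by apply/funext => w; rewrite fejerE.
Qed.

(** Of the L ^ 2 terms of the kernel, the L diagonal ones contribute at most t each. The others have
    frequency of modulus at least L >= 1, so [Ex_alive_pair] bounds each by 2 (K + 4) / L. Averaging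
    leaves O(1 / L). *)
Lemma Ex_alive_fejer (K : R) (j k : 'I_n) (L : nat) : j != k -> 0 <= K -> (0 < L)%N ->
  \forall N \near \oo,
    \int[P]_w (2 * (t / N%:R * \sum_(i < N) alive B X t N K i w *
       fejer L (X j (grid t N i) w - X k (grid t N i) w)))
    <= 2 * (t + 2 * (K + 4)) / L%:R.
Proof.
move=> jk K0 L0; pose th (l l' : nat) : R := (l * L)%:R - (l' * L)%:R.
have L0' : 0 < L%:R :> R by rewrite ltr0n.
have L1 : 1 <= L%:R :> R by rewrite ler1n.
have thL (l l' : 'I_L) : l != l' -> L%:R <= `|th l l'|.
  move=> ll'; rewrite /th; wlog lt_ll' : l l' ll' / (l' < l)%N.
    move=> wl; case: (ltngtP l l') => [lt|lt|/val_inj ll]; last by rewrite ll eqxx in ll'.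
      by rewrite distrC; apply: wl => //; rewrite eq_sym.
    exact: wl.
  rewrite -natrB; last by rewrite leq_mul2r ltnW ?orbT.
  by rewrite -mulnBl normr_nat ler_nat leq_pmull// subn_gt0.
pose I N l l' := t / N%:R * \int[P]_w (\sum_(i < N) alive B X t N K i w *
       cos (th l l' * (X j (grid t N i) w - X k (grid t N i) w))).
have bk N i := bm_alive_full F_filtration F_brownian X_adapted t_gt0 N K i.
have bc N (l l' : nat) i : bounded_measurable (fun w =>
    cos (th l l' * (X j (grid t N i) w - X k (grid t N i) w))).
  by apply: bm_cos; apply: measurable_funM => //; exact: measurable_funB.
have all : \forall N \near \oo, forall ll : 'I_L * 'I_L, ll.1 != ll.2 ->
    `|I N ll.1 ll.2| <= 2 * (K + 4) / L%:R.
  apply: filter_forall => -[l l'] /=; have [->|ll'] := eqVneq l l'.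
    by near=> N.
  have Lth := thL _ _ ll'.
  have th0 : th l l' != 0 by rewrite -normr_gt0 (lt_le_trans L0').
  apply: filterS (Ex_alive_pair jk th0 K0) => N HN _; apply: le_trans HN _.
  rewrite -real_normK ?num_real//; set q := `|th l l'| in Lth *.
  have q0 : 0 < q by exact: lt_le_trans Lth.
  rewrite ler_pdivrMr ?exprn_gt0// mulrAC ler_pdivlMr// expr2.
  have q1 : 1 <= q by exact: le_trans Lth.
  have h1 : q * K * L%:R <= q * K * q by rewrite ler_wpM2l// mulr_ge0// ltW.
  have h2 : L%:R <= q * q by rewrite -[leLHS]mul1r ler_pM.
  lra.
have Npos : \forall N \near \oo, (0 < N)%N by exists 1%N.
apply: filterS2 Npos all => N N0 HI.
have N0' : 0 < N%:R :> R by rewrite ltr0n.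
have -> : \int[P]_w (2 * (t / N%:R * \sum_(i < N) alive B X t N K i w *
       fejer L (X j (grid t N i) w - X k (grid t N i) w))) =
    2 * ((L ^ 2)%:R^-1 * \sum_(l < L) \sum_(l' < L) I N l l').
  transitivity (\int[P]_w (2 * ((L ^ 2)%:R^-1 * \sum_(l < L) \sum_(l' < L)
      (t / N%:R * \sum_(i < N) alive B X t N K i w *
       cos (th l l' * (X j (grid t N i) w - X k (grid t N i) w)))))).
    apply: eq_Rintegral => w _; congr (2 * _).
    under eq_bigr do rewrite fejerE.
    transitivity ((L ^ 2)%:R^-1 * (t / N%:R * \sum_(l < L) \sum_(l' < L)
        \sum_(i < N) alive B X t N K i w *
       cos (th l l' * (X j (grid t N i) w - X k (grid t N i) w)))).
      rewrite [RHS]mulrCA; congr (_ * _).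
      transitivity ((L ^ 2)%:R^-1 * \sum_(i < N) alive B X t N K i w *
          \sum_(l < L) \sum_(l' < L)
          cos (th l l' * (X j (grid t N i) w - X k (grid t N i) w))).
        by rewrite mulr_sumr; apply: eq_bigr => i _; rewrite mulrCA.
      congr (_ * _); under [RHS]eq_bigr do rewrite exchange_big/=.
      rewrite [RHS]exchange_big/=; apply: eq_bigr => i _.
      by rewrite mulr_sumr; apply: eq_bigr => l _; rewrite mulr_sumr.
    congr (_ * _); rewrite mulr_sumr; apply: eq_bigr => l _.
    by rewrite mulr_sumr.
  have b1 (l l' : 'I_L) : bounded_measurable (fun w => \sum_(i < N) alive B X t N K i w *
       cos (th l l' * (X j (grid t N i) w - X k (grid t N i) w))).
    by apply: bm_sum => i _; exact: bmM.
  have b2 (l : 'I_L) : bounded_measurable (fun w => \sum_(l' < L)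
      (t / N%:R * \sum_(i < N) alive B X t N K i w *
       cos (th l l' * (X j (grid t N i) w - X k (grid t N i) w)))).
    by apply: bm_sum => l' _; exact: bmZ.
  rewrite ExZ; last by apply: bmZ; exact: bm_sum.
  rewrite ExZ; last exact: bm_sum.
  rewrite Ex_sum//; congr (_ * (_ * _)); apply: eq_bigr => l _.
  rewrite Ex_sum; last by move=> l' _; exact: bmZ.
  by apply: eq_bigr => l' _; rewrite ExZ.
have Idiag (l : 'I_L) : I N l l <= t.
  have : \int[P]_w (\sum_(i < N) alive B X t N K i w *
       cos (th l l * (X j (grid t N i) w - X k (grid t N i) w))) <= N%:R.
    rewrite -[leRHS](Ex_cst P); apply: Ex_le.
    - by apply: bm_sum => i _; exact: bmM.
    - exact: bm_cst.
    - move=> w; rewrite -[N in leRHS]card_ord -sumr_const; apply: ler_sum => i _.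
      by rewrite /th subrr mul0r cos0 mulr1; have /andP[] := alive_ge0 B X t N K i w.
  move=> /(ler_wpM2l (ltW (divr_gt0 t_gt0 N0'))) H; apply: le_trans H _.
  by rewrite divfK// gt_eqF.
have bound (l l' : 'I_L) : I N l l' <= (l' == l)%:R * t + 2 * (K + 4) / L%:R.
  have c0 : 0 <= 2 * (K + 4) / L%:R by rewrite divr_ge0//; lra.
  have [->|ll'] := eqVneq l' l; first by have := Idiag l; rewrite mul1r; lra.
  rewrite mul0r add0r; apply: le_trans (ler_norm _) _.
  by apply: (HI (l, l')); rewrite eq_sym.
apply: (@le_trans _ _ (2 * ((L ^ 2)%:R^-1 * \sum_(l < L) \sum_(l' < L)
    ((l' == l)%:R * t + 2 * (K + 4) / L%:R)))).
  do 2 (rewrite ler_wpM2l ?invr_ge0//).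
  by apply: ler_sum => l _; apply: ler_sum => l' _.
have -> : \sum_(l < L) \sum_(l' < L) ((l' == l)%:R * t + 2 * (K + 4) / L%:R) =
    L%:R * (t + 2 * (K + 4)).
  rewrite (eq_bigr (fun=> t + 2 * (K + 4))); last first.
    move=> l _; rewrite big_split/= -mulr_suml sumr_const card_ord.
    rewrite (bigD1 l)//= eqxx big1 ?addr0; last by move=> i /negbTE ->.
    by rewrite mul1r -[X in _ + X]mulr_natr divfK// gt_eqF.
  by rewrite sumr_const card_ord [RHS]mulr_natl.
by rewrite natrX le_eqVlt; apply/orP; left; apply/eqP; field; rewrite gt_eqF.
Unshelve. all: by end_near. Qed.

(** The event on which no grid, whatever its mesh, is stopped at level K. The stopped sums are there
    the full sums. *)
Definition tame (K : nat) : set T :=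
  \bigcap_N [set w | drift_variation B X t N N w <= K%:R].

Lemma measurable_tame K : measurable (tame K).
Proof.
have mv N i : measurable_fun setT (drift_variation B X t N i).
  apply: measurable_sum => l; apply: measurable_sum => j'.
  apply: measurableT_comp => //.
  by apply: measurable_funB; exact: measurable_increment.
apply: bigcap_measurableType => N _.
rewrite (_ : [set _ | _] = drift_variation B X t N N @^-1` `]-oo, K%:R]); last first.
  by apply/seteqP; split => w /=; rewrite in_itv.
by rewrite -[X in measurable X]setTI; exact: mv.
Qed.

Lemma alive_tame K N i w : (i <= N)%N -> w \in tame K -> alive B X t N K%:R i w = 1.
Proof.
move=> iN /set_mem /(_ N I) wK; rewrite /alive.
suff -> : drift_variation B X t N i w <= K%:R by [].
apply: le_trans wK; apply: (@nondecreasing_leq _ (drift_variation B X t N ^~ w)) => //.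
exact: drift_variation_le.
Qed.

Lemma ae_collision_null (j k : 'I_n) : j != k ->
  {ae P, forall w, mu (collision_times t (fun s => X j s w - X k s w)) = 0%E}.
Proof.
move=> jk; pose E := tame; have mE := measurable_tame.
pose C w := collision_times t (fun s => X j s w - X k s w).
(* The indicator of [tame] K is at most [alive], which brings in the stopped estimate; [L.+1] avoids
   the degenerate kernel of order 0. *)
pose Q K (L N : nat) w : R := \1_(E K) w * (2 * (t / N%:R *
   \sum_(i < N) fejer L.+1 (X j (grid t N i) w - X k (grid t N i) w))).
have bQ K L N : bounded_measurable (Q K L N).
  apply: bmM; first exact: bm_indic.
  by do 2 apply: bmZ; apply: bm_sum => i _; exact: bm_fejer.
have h0 N : 0 <= t / N%:R by rewrite divr_ge0// ltW.
have S0 L N w : 0 <= 2 * (t / N%:R *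
   \sum_(i < N) fejer L.+1 (X j (grid t N i) w - X k (grid t N i) w)).
  apply: mulr_ge0 => //; apply: mulr_ge0; first exact: h0.
  by apply: sumr_ge0 => i _; exact: fejer_ge0.
have null K : {ae P, forall w, ((if w \in E K then mu (C w) else 0) <= 0)%E}.
  pose c (L : nat) : R := 2 * (t + 2 * (K%:R + 4)) / L.+1%:R.
  have num0 : 0 <= 2 * (t + 2 * (K%:R + 4)) :> R.
    by rewrite mulr_ge0// addr_ge0 ?ltW// mulr_ge0// addr_ge0.
  apply: (@ae_le0_double_limit _ _ _ P (Q K) c) => //.
  - by move=> L N w; rewrite mulr_ge0// indicE.
  - move=> e e0; exists (Num.trunc (2 * (t + 2 * (K%:R + 4)) / e)).
    rewrite /c ler_pdivrMr ?ltr0n// [e * _]mulrC -ler_pdivrMr//; apply: ltW.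
    exact: truncnS_gt.
  - move=> L; apply: filterS (Ex_alive_fejer jk (ler0n _ K) (ltn0Sn L)) => N.
    apply: le_trans; apply: Ex_le => //.
      do 2 apply: bmZ; apply: bm_sum => i _; apply: bmM; last exact: bm_fejer.
      exact: (bm_alive_full F_filtration F_brownian X_adapted t_gt0 N K%:R i).
    move=> w; rewrite /Q indicE; case: (boolP (w \in E K)) => wE; last first.
      rewrite mul0r; apply: mulr_ge0 => //; apply: mulr_ge0; first exact: h0.
      apply: sumr_ge0 => i _.
      by rewrite mulr_ge0 ?fejer_ge0//; have /andP[] := alive_ge0 B X t N K%:R i w.
    rewrite mul1r ler_wpM2l// ler_wpM2l ?h0//; apply: ler_sum => i _.
    by rewrite alive_tame ?mul1r// ltnW.
  - have [cj ck] := (X_continuous j, X_continuous k).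
    apply: filterS2 cj ck => w cj ck L; case: ifPn => wE; last first.
      near=> N; by rewrite lee_fin /Q mulr_ge0 ?indicE.
    have cy : {within `[0, +oo[, continuous (fun s : R => X j s w - X k s w)}.
      by move=> s; apply: continuousB; [exact: cj|exact: ck].
    apply: filterS (collision_measure_le t_gt0 (ltn0Sn L) cy) => N.
    by rewrite /Q indicE wE mul1r.
have := ae_foralln null; apply: filterS2 bounded_variation => w [K HK] /(_ K).
have -> : w \in E K by apply/mem_set => N _; exact: HK.
by rewrite measure_le0 => /eqP.
Unshelve. all: by end_near. Qed.

End CollisionsAreNull.

(** * The drift over one step *)

Lemma sin_lipschitz (R : realType) (x y : R) : `|sin x - sin y| <= `|x - y|.
Proof.
rewrite -!cosBpihalf (le_trans (cos_lipschitz _ _))//.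
by have -> : x - pi / 2 - (y - pi / 2) = x - y by ring.
Qed.

(** Expansion about y, the phase at the right end of a step, with u the drift over the step. The
    derivative of the error is a difference of sines, hence at most |u|. *)
Lemma cos_taylor1 (R : realType) (y u : R) :
  `|cos y - cos (y - u) + u * sin y| <= u ^+ 2.
Proof.
have half (s v : R) : `|s| = 1 -> 0 <= v ->
    `|cos y - cos (y - s * v) + s * v * sin y| <= v * v.
  move=> s1 v0.
  apply: (@normr_le_derive _ (fun v => cos y - cos (y - s * v) + s * v * sin y)
    (fun v => s * (sin y - sin (y - s * v)))) => //.
  - by move=> w; apply: is_derive_eq; rewrite /GRing.scale/=; ring.
  - by rewrite mulr0 subr0 mul0r addr0 subrr.
  - move=> w /andP[w0 wv]; rewrite normrM s1 mul1r (le_trans (sin_lipschitz _ _))//.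
    by rewrite subKr normrM s1 mul1r ger0_norm.
have [u0|u0] := leP 0 u.
  by have := half 1 u (normr1 _) u0; rewrite !mul1r -expr2.
have := half (-1) (- u) _ _; rewrite !mulN1r !opprK mulrNN -expr2.
by apply; rewrite ?normrN1// oppr_ge0 ltW.
Qed.

Section AffineIntegrals.
Context {R : realType}.
Notation mu := (@lebesgue_measure R).
Variables (n : nat) (u v : R) (f : 'I_n -> R -> R).
Hypothesis uv : u <= v.
Hypothesis f_int : forall j, mu.-integrable `]u, v] (EFin \o f j).

Lemma lebesgue_measure_oc : mu `]u, v] = (v - u)%:E.
Proof.
rewrite lebesgue_measure_itv/= lte_fin; have [//|vu] := ltP u v.
by have -> : v = u by [apply/le_anti; rewrite vu uv]; rewrite subrr.
Qed.

Lemma integrable_cst_itv (c : R) : mu.-integrable `]u, v] (EFin \o cst c).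
Proof.
apply: measurable_bounded_integrable => //; last exact: bounded_cst.
by have := ltry (v - u); rewrite -lebesgue_measure_oc.
Qed.

Lemma Rintegral_cst_itv (c : R) : \int[mu]_(r in `]u, v]) c = c * (v - u).
Proof.
rewrite Rintegral_cst//; congr (_ * _).
exact: (congr1 fine lebesgue_measure_oc).
Qed.

Lemma affine_integral (c0 : R) (c : 'I_n -> R) :
  mu.-integrable `]u, v] (EFin \o (fun r => c0 + \sum_j c j * f j r)) /\
  \int[mu]_(r in `]u, v]) (c0 + \sum_j c j * f j r) =
  c0 * (v - u) + \sum_j c j * \int[mu]_(r in `]u, v]) f j r.
Proof.
suff: forall s : seq 'I_n,
    mu.-integrable `]u, v] (EFin \o (fun r => c0 + \sum_(j <- s) c j * f j r)) /\
    \int[mu]_(r in `]u, v]) (c0 + \sum_(j <- s) c j * f j r) =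
    c0 * (v - u) + \sum_(j <- s) c j * \int[mu]_(r in `]u, v]) f j r by exact.
elim => [|j s [IHi IHe]].
  rewrite big_nil addr0 (_ : (fun r => _) = cst c0); last first.
    by apply/funext => r; rewrite big_nil addr0.
  by split; [exact: integrable_cst_itv|exact: Rintegral_cst_itv].
have -> : (fun r => c0 + \sum_(i <- j :: s) c i * f i r) =
    (fun r => c j * f j r + (c0 + \sum_(i <- s) c i * f i r)).
  by apply/funext => r; rewrite big_cons addrCA.
have ic : mu.-integrable `]u, v] (EFin \o (fun r => c j * f j r)).
  exact: (integrableZl _ (c j) (f_int j)).
split; first exact: (integrableD _ ic IHi).
rewrite (RintegralD _ ic IHi)// IHe (RintegralZl _ _ (f_int j))// big_cons.
by rewrite addrCA.
Qed.

End AffineIntegrals.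

Lemma affine_integral_le (R : realType) (n : nat) (u v : R) (f : 'I_n -> R -> R)
    (c0 : R) (c : 'I_n -> R) (M0 M1 : R) :
  u <= v -> (forall j, lebesgue_measure.-integrable `]u, v] (EFin \o f j)) ->
  0 <= M0 -> 0 <= M1 ->
  {ae lebesgue_measure, forall r, r \in `]u, v] ->
    `|c0 + \sum_j c j * f j r| <= M0 + \sum_j M1 * `|f j r|} ->
  `|c0 * (v - u) + \sum_j c j * \int[lebesgue_measure]_(r in `]u, v]) f j r| <=
  M0 * (v - u) + \sum_j M1 * \int[lebesgue_measure]_(r in `]u, v]) `|f j r|.
Proof.
move=> uv fi M00 M10 ae.
have gi j : lebesgue_measure.-integrable `]u, v] (EFin \o (fun r => `|f j r|)).
  exact: (integrable_norm (fi j)).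
have [i1 <-] := affine_integral uv fi c0 c.
have [i2 <-] := affine_integral uv gi M0 (fun=> M1).
apply: le_trans (le_normr_Rintegral _ i1) _ => //.
have i1' := integrable_norm i1.
rewrite /Rintegral fine_le//; [exact: integrable_fin_num i1'|exact: integrable_fin_num i2|].
apply: ae_ge0_le_integral => //.
- exact: measurable_int i1'.
- move=> r _; rewrite lee_fin addr_ge0// sumr_ge0// => j _.
  by rewrite mulr_ge0.
- exact: measurable_int i2.
Qed.

Section StepEstimate.
Context {R : realType}.
Notation mu := (@lebesgue_measure R).
Variables (n m : nat) (lam phi : R).
Hypothesis lam_ge0 : 0 <= lam.

Let drift_rate : R := lam * (m%:R * (n - m)%:R).

Definition drift (x : 'I_n -> R -> R) (j : 'I_n) (s : R) : R :=
  lam * \sum_(k < n | k != j) cot ((x j s - x k s) / 2).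

Definition member (S : {set 'I_n}) (j : 'I_n) : R := (j \in S)%:R.

Notation angle x S s := (subset_phase (fun j => x j s) phi S).

Lemma angle_dist (x : 'I_n -> R -> R) (S : {set 'I_n}) (r s e : R) :
  (forall j, `|x j r - x j s| <= e) -> `|angle x S r - angle x S s| <= n%:R * e.
Proof.
move=> H; rewrite /subset_phase opprD addrACA subrr add0r -sumrB.
rewrite (le_trans (ler_norm_sum _ _ _))// -[n in leRHS]card_ord mulr_natl -sumr_const.
apply: ler_sum => j _; rewrite -mulrBr normrM (le_trans _ (H j))//.
by rewrite ler_piMl// normr_nat lern1 leq_b1.
Qed.

(** The angles are frozen at v. At almost every r in the interval there is no collision, so
    [drift_identity] at r may be subtracted for free; what is left is the variation of sine and
    cosine between r and v, at most n e for each set, times the drift rate plus the absolute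
    drift. *)
Lemma drift_sum_small (x : 'I_n -> R -> R) (u v e : R) : 0 <= u -> u <= v -> 0 <= e ->
  (forall j, mu.-integrable `]u, v] (EFin \o drift x j)) ->
  (forall j k, j != k -> mu.-negligible (collision_times v (fun s => x j s - x k s))) ->
  (forall j r, u < r <= v -> `|x j v - x j r| <= e) ->
  `|\sum_(S : {set 'I_n} | #|S| == m)
     (drift_rate * (v - u) * cos (angle x S v)
      - (\sum_j (j \in S)%:R * \int[mu]_(r in `]u, v]) drift x j r)
        * sin (angle x S v))| <=
  #|{: {set 'I_n}}|%:R * (n%:R * e) *
   (drift_rate * (v - u) + \sum_j \int[mu]_(r in `]u, v]) `|drift x j r|).
Proof.
move=> u0 uv e0 di coll osc.
have rate0 : 0 <= drift_rate by rewrite mulr_ge0// mulr_ge0.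
pose c0 := \sum_(S : {set 'I_n} | #|S| == m) drift_rate * cos (angle x S v).
pose c j := - \sum_(S : {set 'I_n} | #|S| == m) (j \in S)%:R * sin (angle x S v).
(* The sum is affine in the drift. The same identity serves for the integral, with D = v - u, and
   for the integrand at a point, with D = 1. *)
have splitE (D : R) (z : 'I_n -> R) :
    \sum_(S : {set 'I_n} | #|S| == m) (drift_rate * D * cos (angle x S v)
      - (\sum_j (j \in S)%:R * z j) * sin (angle x S v)) =
    c0 * D + \sum_j c j * z j.
  rewrite sumrB; congr (_ + _).
    by rewrite /c0 mulr_suml; apply: eq_bigr => S _; ring.
  rewrite -sumrN; under [RHS]eq_bigr do rewrite mulNr mulr_suml -sumrN.
  rewrite [RHS]exchange_big/=; apply: eq_bigr => S _.
  by rewrite mulr_suml -sumrN; apply: eq_bigr => j _; ring.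
rewrite splitE; set A := #|_|%:R * (n%:R * e).
have A0 : 0 <= A by rewrite mulr_ge0// mulr_ge0.
have -> : A * (drift_rate * (v - u) + \sum_j \int[mu]_(r in `]u, v]) `|drift x j r|) =
    A * drift_rate * (v - u) + \sum_j A * \int[mu]_(r in `]u, v]) `|drift x j r|.
  by rewrite mulrDr mulrA mulr_sumr.
apply: affine_integral_le => //; first exact: mulr_ge0.
have aeZ : {ae mu, forall r, forall jk : 'I_n * 'I_n, jk.1 != jk.2 ->
    ~ collision_times v (fun s => x jk.1 s - x jk.2 s) r}.
  apply: (@filter_forall _ _ _ _ (ae_filter_ringOfSetsType mu)) => jk.
  have [->|jk12] := eqVneq jk.1 jk.2.
    exact: nearW.
  apply: negligibleS (coll _ _ jk12) => r /= /existsNP[_].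
  exact: contrapT.
apply: (@filterS _ _ (ae_filter_ringOfSetsType mu) _ _ _ aeZ) => r rZ.
rewrite in_itv/= => /andP[ur rv].
have sep (j k : 'I_n) : j != k -> sin ((x j r - x k r) / 2) != 0.
  move=> jk; apply/eqP => s0; apply: (rZ (j, k) jk); split => //=.
  by rewrite rv (le_trans u0 (ltW ur)).
have idr := @drift_identity _ n (fun j => x j r) sep phi lam m.
rewrite -[c0 in leLHS]mulr1 -(splitE 1 (fun j => drift x j r)).
rewrite -[X in `|X| <= _]subr0 -[X in `|_ - X| <= _]idr -sumrB.
apply: (@le_trans _ _ (\sum_(S : {set 'I_n}) (n%:R * e) *
   (drift_rate + \sum_j `|drift x j r|))); last first.
  have -> : A * drift_rate + \sum_j A * `|drift x j r| =
      #|{: {set 'I_n}}|%:R * (n%:R * e * (drift_rate + \sum_j `|drift x j r|)).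
    by rewrite -mulr_sumr /A; ring.
  by rewrite sumr_const [leRHS]mulr_natl.
rewrite (le_trans (ler_norm_sum _ _ _))// big_mkcond/=; apply: ler_sum => S _.
have B0 : 0 <= drift_rate + \sum_j `|drift x j r| by rewrite addr_ge0// sumr_ge0.
have ne0 : 0 <= n%:R * e by rewrite mulr_ge0.
case: ifP => _; last exact: mulr_ge0.
have dist : `|angle x S v - angle x S r| <= n%:R * e.
  by apply: angle_dist => j; apply: osc; rewrite ur.
rewrite -/(angle x S r) mulr1.
have -> : \sum_j (j \in S)%:R * (lam * \sum_(k < n | k != j) cot ((x j r - x k r) / 2)) =
  \sum_j (j \in S)%:R * drift x j r by [].
set D := \sum_j (j \in S)%:R * drift x j r.
have Dle : `|D| <= \sum_j `|drift x j r|.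
  rewrite (le_trans (ler_norm_sum _ _ _))//; apply: ler_sum => j _.
  by rewrite normrM ler_piMl// normr_nat lern1 leq_b1.
have -> : drift_rate * cos (angle x S v) - D * sin (angle x S v) -
    (lam * (m%:R * (n - m)%:R) * cos (angle x S r) - D * sin (angle x S r)) =
    drift_rate * (cos (angle x S v) - cos (angle x S r)) -
    D * (sin (angle x S v) - sin (angle x S r)) by rewrite /drift_rate; ring.
apply: le_trans (ler_normB _ _) _; rewrite [leRHS]mulrDr; apply: lerD.
  rewrite normrM (ger0_norm rate0) [leRHS]mulrC ler_wpM2l//.
  exact: le_trans (cos_lipschitz _ _) dist.
rewrite normrM [leRHS]mulrC; apply: ler_pM => //.
exact: le_trans (sin_lipschitz _ _) dist.
Qed.

End StepEstimate.

Lemma has_rate_near (R : realType) (f : R -> R) (p t e : R) : 0 < t -> 0 < e ->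
  has_rate f p ->
  \forall N \near \oo, `|f (t / N%:R) - (1 - p * (t / N%:R))| <= e * (t / N%:R).
Proof.
move=> t0 e0 [C [e' [C0 e'0 H]]].
have C1 : 0 < C + 1 by lra.
have m0 : 0 < Num.min e' (e / (C + 1)) by rewrite lt_min e'0 divr_gt0.
apply: filterS (near_step t0 m0) => N [N0]; rewrite lt_min => /andP[he].
have h0 : 0 < t / N%:R by rewrite divr_gt0// ltr0n.
rewrite ltr_pdivlMr// => hC; apply: le_trans (H _ h0 he) _.
set h := t / N%:R in h0 hC *; rewrite expr2 mulrA.
by apply: ler_wpM2r; [exact: ltW|lra].
Qed.

(** * Estimates along a single regular path *)

Section Paths.
Context {d : measure_display} {T : measurableType d} {R : realType}.
Variable P : probability T R.
Variables (n : nat) (lambda : R) (B X : 'I_n -> R -> {RV P >-> R}).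
Hypothesis lambda_ge0 : 0 <= lambda.
Variable t : R.
Hypothesis t_gt0 : 0 < t.
Notation mu := (@lebesgue_measure R).

Definition regular_path (w : T) : Prop :=
  [/\ forall j, {within `[0, +oo[, continuous (fun s : R => X j s w : R)},
      forall j, {within `[0, +oo[, continuous (fun s : R => B j s w : R)} &
      forall j s, 0 <= s ->
         mu.-integrable `[0, s] (fun s => (cot_drift lambda X j s w)%:E) /\
         X j s w = X j 0 w + increment (B j) 0 s w
           + \int[mu]_(s in `[0, s]) cot_drift lambda X j s w].

(** Unlike the grid variation, which it dominates on regular paths, this is additive over the steps,
    so its sum is bounded independently of N. *)
Definition mass N i w : R := \sum_j
  \int[mu]_(s in `]grid t N i, grid t N i.+1]) `|cot_drift lambda X j s w|.

Section RegularPath.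
Variable w : T.
Hypothesis regular_w : regular_path w.

Lemma integrable_drift j u v : 0 <= u -> u <= v ->
  mu.-integrable `]u, v] (EFin \o (fun s => cot_drift lambda X j s w)).
Proof.
move=> u0 uv; have [_ _ /(_ j v (le_trans u0 uv))[iv _]] := regular_w.
apply: integrableS iv => //; apply: subset_itvr; rewrite bnd_simp.
exact: u0.
Qed.

Lemma Rintegral_oc (f : R -> R) u v : mu.-integrable `[0, v] (EFin \o f) ->
  0 <= u -> u <= v ->
  \int[mu]_(s in `]u, v]) f s = \int[mu]_(s in `[0, v]) f s - \int[mu]_(s in `[0, u]) f s.
Proof. by move=> iv u0 uv; rewrite Rintegral_itvB// bnd_simp. Qed.

Lemma drift_stepE N j i :
  drift_step B X t N j i w =
  \int[mu]_(s in `]grid t N i, grid t N i.+1]) cot_drift lambda X j s w.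
Proof.
have g0 := grid_ge0 t_gt0 N i; have g1 := grid_ge0 t_gt0 N i.+1.
have gg : grid t N i <= grid t N i.+1 by exact: grid_le.
have [_ _ H] := regular_w.
have [i1 E1] := H j _ g1; have [i0 E0] := H j _ g0.
rewrite (Rintegral_oc i1)// /drift_step {1}/increment E1 E0 /increment.
by ring.
Qed.

Lemma drift_step_le N i : \sum_j `|drift_step B X t N j i w| <= mass N i w.
Proof.
apply: ler_sum => j _; rewrite drift_stepE; apply: le_normr_Rintegral => //.
by apply: integrable_drift; [exact: grid_ge0|exact: grid_le].
Qed.

Lemma mass_ge0 N i : 0 <= mass N i w.
Proof. by apply: sumr_ge0 => j _; apply: Rintegral_ge0. Qed.

Lemma sum_mass_le N :
  \sum_(i < N) mass N i w <= \sum_j \int[mu]_(s in `[0, t]) `|cot_drift lambda X j s w|.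
Proof.
rewrite exchange_big/=; apply: ler_sum => j _.
have [_ _ H] := regular_w.
pose V s := \int[mu]_(r in `[0, s]) `|cot_drift lambda X j r w|.
have V0 s : 0 <= V s by apply: Rintegral_ge0.
have [->|N0] := posnP N; first by rewrite big_ord0; exact: V0.
rewrite (eq_bigr (fun i : 'I_N => V (grid t N i.+1) - V (grid t N i))); last first.
  move=> i _; apply: Rintegral_oc; [|exact: grid_ge0|exact: grid_le].
  exact: (integrable_norm (H j _ (grid_ge0 t_gt0 N i.+1)).1).
rewrite -(big_mkord xpredT (fun i => V (grid t N i.+1) - V (grid t N i))).
rewrite telescope_sumr//.
have -> : grid t N N = t by rewrite /grid mulrC divfK// pnatr_eq0 -lt0n.
by rewrite -[leRHS]subr0 lerB.
Qed.

Lemma regular_bounded_variation : exists K : nat,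
  forall N, drift_variation B X t N N w <= K%:R.
Proof.
set V := \sum_j \int[mu]_(s in `[0, t]) `|cot_drift lambda X j s w|.
exists (Num.trunc V).+1 => N.
apply: le_trans (ltW (truncnS_gt V)); apply: le_trans (sum_mass_le N).
by apply: ler_sum => i _; exact: drift_step_le.
Qed.

Hypothesis no_collision : forall j k, j != k ->
  mu.-negligible (collision_times t (fun s => X j s w - X k s w)).

Lemma near_oscillation (Y : 'I_n -> R -> R) (e : R) : 0 < e ->
  (forall j, {within `[0, +oo[, continuous (Y j)}) ->
  \forall N \near \oo, forall j u v, 0 <= u <= t -> 0 <= v <= t ->
    `|u - v| <= t / N%:R -> `|Y j u - Y j v| <= e.
Proof.
move=> e0 cY; apply: filter_forall => j.
have [del del0 H] := within_continuous_heine t (cY j) e0.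
apply: filterS (near_step t_gt0 del0) => N [_ hdel] u v u0 v0 uv.
by apply: H => //; exact: le_trans uv (ltW hdel).
Qed.

Definition growth (m : nat) : R := m%:R / 2 + lambda * (m%:R * (n - m)%:R).

(** To first order the remainder of S is [main] S: the part m / 2 of the growth compensates the
    Brownian decay, the other part meets the drift. The sum of [main] over S is small by the
    pairing, and [err] collects the expansion errors. The factor h + mass makes the bound summable
    over the grid. *)
Lemma remainder_sum_small (m : nat) (phi e : R) : 0 < e ->
  \forall N \near \oo, forall i, (i < N)%N ->
    `|\sum_(S : {set 'I_n} | #|S| == m) remainder B X t (member S) phi (growth m) N i w|
    <= e * (t / N%:R + mass N i w).
Proof.
move=> e_gt0; pose M : R := #|{: {set 'I_n}}|%:R.
pose q : R := m%:R / 2; pose rate : R := lambda * (m%:R * (n - m)%:R).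
have q0 : 0 <= q by rewrite divr_ge0.
have rate0 : 0 <= rate by rewrite mulr_ge0// mulr_ge0.
have M0 : 0 <= M by exact: ler0n.
have n0 : 0 <= n%:R :> R by exact: ler0n.
(* D collects the errors in units of e'. In h: 2 from the two rates, q n from moving the cosine from
   u to v, n rate from [main]. In the mass: n from [main] and 2 n from the Taylor error. The final 1
   keeps D positive. *)
pose D := M * (2 + q * n%:R + n%:R * rate + 3 * n%:R) + 1.
have D1 : 0 < D.
  by rewrite /D ltr_wpDl// mulr_ge0// !addr_ge0// mulr_ge0.
pose e' := e / D; have e'0 : 0 < e' by rewrite divr_gt0.
have [cX cB _] := regular_w.
have rates : \forall N \near \oo, forall S : {set 'I_n}, #|S| == m ->
    `|gauss_cos (member S) (t / N%:R) - (1 - q * (t / N%:R))| <= e' * (t / N%:R).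
  apply: filter_forall => S; have [Sm|_] := eqVneq #|S| m; last exact: nearW.
  apply: filterS (has_rate_near t_gt0 e'0 (has_rate_gauss_cos (member S))) => N + _.
  have -> : \sum_j member S j ^+ 2 / 2 = q.
    rewrite -mulr_suml /q -Sm -sum1_card natr_sum [in RHS]big_mkcond/=; congr (_ / _).
    by apply: eq_bigr => j _; rewrite /member; case: (j \in S); rewrite ?expr1n ?expr0n.
  by [].
have rate_e := has_rate_near t_gt0 e'0 (has_rate_expR (growth m)).
have oX := near_oscillation e'0 cX.
have oB := near_oscillation e'0 cB.
have Npos : \forall N \near \oo, (0 < N)%N by exists 1%N.
near=> N => i iN.
have N0 : (0 < N)%N by near: N.
set h := t / N%:R; have h0 : 0 < h by rewrite divr_gt0// ltr0n.
pose u := grid t N i; pose v := grid t N i.+1.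
have u0 : 0 <= u by exact: grid_ge0.
have uv : u <= v by exact: grid_le.
have vu : v - u = h by exact: gridS.
have vt : v <= t.
  have -> : t = grid t N N by rewrite /grid mulrC divfK// pnatr_eq0 -lt0n.
  exact: grid_le.
have m0 := mass_ge0 N i.
have rs : forall S : {set 'I_n}, #|S| == m ->
    `|gauss_cos (member S) h - (1 - q * h)| <= e' * h by rewrite /h; near: N.
have re : `|expR (growth m * h) - (1 - - growth m * h)| <= e' * h by rewrite /h; near: N.
have ox : forall j (r s : R), 0 <= r <= t -> 0 <= s <= t -> `|r - s| <= h ->
    `|X j r w - X j s w| <= e' by rewrite /h; near: N.
have ob : forall j (r s : R), 0 <= r <= t -> 0 <= s <= t -> `|r - s| <= h ->
    `|B j r w - B j s w| <= e' by rewrite /h; near: N.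
have oc r : u < r <= v -> 0 <= r <= t /\ `|v - r| <= h.
  move=> /andP[ur rv]; split.
    by rewrite (le_trans u0 (ltW ur)) (le_trans rv vt).
  by rewrite ger0_norm ?subr_ge0// -vu lerB// ltW.
have v_in : 0 <= v <= t by rewrite (le_trans u0 uv) vt.
have u_in : 0 <= u <= t by rewrite u0 (le_trans uv vt).
pose ds j := drift_step B X t N j i w.
pose an (S : {set 'I_n}) s := phase X (member S) phi s w.
pose main (S : {set 'I_n}) := rate * h * cos (an S v)
   - (\sum_j (j \in S)%:R * ds j) * sin (an S v).
pose err (S : {set 'I_n}) := remainder B X t (member S) phi (growth m) N i w - main S.
have mainle : `|\sum_(S : {set 'I_n} | #|S| == m) main S| <=
    M * (n%:R * e') * (rate * h + mass N i w).
  rewrite /main -vu.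
  under eq_bigr do under eq_bigr do rewrite /ds drift_stepE.
  apply: (@drift_sum_small R n m lambda phi lambda_ge0 (fun j s => X j s w) u v e') => //.
  - exact: ltW.
  - by move=> j; exact: integrable_drift.
  - move=> j k jk; apply: negligibleS (no_collision jk) => s [/andP[s0 sv] ?].
    by split => //; rewrite s0 (le_trans sv vt).
  - by move=> j r ur; have [rt vr] := oc r ur; exact: ox.
have dsle (S : {set 'I_n}) : `|drift_phase B X t (member S) N i w| <= mass N i w /\
    `|drift_phase B X t (member S) N i w| <= 2 * (n%:R * e').
  have le1 : `|drift_phase B X t (member S) N i w| <= \sum_j `|ds j|.
    rewrite (le_trans (ler_norm_sum _ _ _))//; apply: ler_sum => j _.
    by rewrite normrM ler_piMl// normr_nat lern1 leq_b1.
  split; first exact: le_trans le1 (drift_step_le N i).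
  apply: le_trans le1 _; rewrite mulrCA -[n in leRHS]card_ord mulr_natl -sumr_const.
  apply: ler_sum => j _; rewrite /ds /drift_step (le_trans (ler_normB _ _))//.
  have hu : `|v - u| <= h by rewrite vu ger0_norm// ltW.
  have := ox j v u v_in u_in hu; have := ob j v u v_in u_in hu.
  rewrite /increment -/u -/v; lra.
have errle (S : {set 'I_n}) : #|S| == m -> `|err S| <=
    2 * (e' * h) + q * h * (n%:R * e') + 2 * (n%:R * e') * mass N i w.
  move=> Sm; have := rs S Sm; set rho := gauss_cos _ _ => rhoS.
  have [d1 d2] := dsle S; set dd := drift_phase B X t (member S) N i w in d1 d2.
  have -> : err S = (expR (growth m * h) - (1 - - growth m * h)) * cos (an S v)
     + (rho - (1 - q * h)) * cos (an S u) + q * h * (cos (an S v) - cos (an S u))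
     + (cos (an S v) - cos (an S v - dd) + dd * sin (an S v)).
    rewrite /err /main /remainder -/h -/rho -/u -/v -/(an S u) -/(an S v) -/dd.
    rewrite (_ : \sum_j (j \in S)%:R * ds j = dd)// /growth -/q -/rate; ring.
  have cle y : `|cos y| <= 1 :> R by rewrite ler_norml cos_geN1 cos_le1.
  have t1 : `|(expR (growth m * h) - (1 - - growth m * h)) * cos (an S v)| <= e' * h.
    by rewrite normrM -[leRHS]mulr1 ler_pM.
  have t2 : `|(rho - (1 - q * h)) * cos (an S u)| <= e' * h.
    by rewrite normrM -[leRHS]mulr1 ler_pM.
  have t3 : `|q * h * (cos (an S v) - cos (an S u))| <= q * h * (n%:R * e').
    have qh : 0 <= q * h by rewrite mulr_ge0// ltW.
    rewrite normrM (ger0_norm qh) ler_wpM2l// (le_trans (cos_lipschitz _ _))//.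
    apply: (@angle_dist R n phi (fun j s => X j s w) S v u e') => j.
    by apply: ox => //; rewrite vu ger0_norm// ltW.
  have t4 : `|cos (an S v) - cos (an S v - dd) + dd * sin (an S v)| <=
      2 * (n%:R * e') * mass N i w.
    apply: le_trans (cos_taylor1 _ _) _.
    by rewrite -real_normK ?num_real// expr2 ler_pM.
  rewrite (le_trans (ler_normD _ _))// lerD// (le_trans (ler_normD _ _))// lerD//.
  by rewrite (le_trans (ler_normD _ _))//; lra.
rewrite (eq_bigr (fun S => main S + err S)); last by move=> S _; rewrite /err addrC subrK.
rewrite big_split/= (le_trans (ler_normD _ _))//.
pose E := 2 * (e' * h) + q * h * (n%:R * e') + 2 * (n%:R * e') * mass N i w.
have E0 : 0 <= E.
  have [e'1 h1] := (ltW e'0, ltW h0); have ne' := mulr_ge0 n0 e'1.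
  apply: addr_ge0; [apply: addr_ge0|].
  - by apply: mulr_ge0 => //; exact: mulr_ge0.
  - by apply: mulr_ge0 => //; exact: mulr_ge0.
  - by apply: mulr_ge0 => //; exact: mulr_ge0.
have errsum : `|\sum_(S : {set 'I_n} | #|S| == m) err S| <= M * E.
  rewrite (le_trans (ler_norm_sum _ _ _))// big_mkcond/=.
  apply: (@le_trans _ _ (\sum_(S : {set 'I_n}) E)); last by rewrite sumr_const mulr_natl.
  by apply: ler_sum => S _; case: ifPn => // Sm; exact: errle.
have eE : e = e' * D by rewrite /e' divfK// gt_eqF.
have : M * (n%:R * e') * (rate * h + mass N i w) + M * E <= e * (h + mass N i w).
  rewrite eE /D /E.
  have -> : M * (n%:R * e') * (rate * h + mass N i w) + M * (2 * (e' * h) +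
      q * h * (n%:R * e') + 2 * (n%:R * e') * mass N i w) =
    e' * (M * ((2 + q * n%:R + n%:R * rate) * h + 3 * n%:R * mass N i w)) by ring.
  rewrite -[leRHS]mulrA; apply: ler_wpM2l; first exact: ltW.
  rewrite [leRHS]mulrDl mul1r -[X in _ <= X + _]mulrA.
  apply: ler_wpDr; first by rewrite addr_ge0// ltW.
  have [qn rn] := (mulr_ge0 q0 n0, mulr_ge0 n0 rate0).
  apply: ler_wpM2l => //; rewrite [leRHS]mulrDr; apply: lerD.
    by apply: ler_wpM2r; [exact: ltW|lra].
  by apply: ler_wpM2r => //; lra.
by move: mainle errsum; lra.
Unshelve. all: by end_near. Qed.

End RegularPath.

End Paths.

(** * Passage to the limit *)

Section DominatedLimit.
Context {d : measure_display} {T : measurableType d} {R : realType}.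
Variable P : probability T R.

Lemma Ex_dominated_cvg0 (Z : nat -> T -> R) (C : R) :
  (forall N, bounded_measurable (Z N)) ->
  (\forall N \near \oo, forall w, `|Z N w| <= C) ->
  {ae P, forall w, forall e : R, 0 < e -> \forall N \near \oo, `|Z N w| <= e} ->
  forall e : R, 0 < e -> \forall N \near \oo, `|\int[P]_w Z N w| <= e.
Proof.
move=> bZ [N0 _ ZC] Z0 e e0.
(* The bound C holds only from N0 on, so the sequence is shifted before dominated convergence. *)
pose f (k : nat) w := (Z (k + N0)%N w)%:E.
have mf k : measurable_fun setT (f k) by apply/measurable_EFinP; exact: (bZ _).1.
have f0 : {ae P, forall w, setT w -> f ^~ w @ \oo --> (cst 0 w : \bar R)}.
  apply: filterS Z0 => w Z0 _; apply/fine_cvgP; split; first exact: nearW.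
  apply/cvgrPdist_le => eps /Z0 [N1 _ H]; exists N1 => // k /= kN.
  by rewrite sub0r normrN; apply: H => /=; rewrite (leq_trans kN)// leq_addr.
have fC : {ae P, forall w k, setT w -> (`|f k w| <= cst C%:E w)%E}.
  by apply: nearW => w k _; rewrite lee_fin; apply: ZC => /=; exact: leq_addl.
have [_ _] := dominated_convergence measurableT mf (measurable_cst _) f0
  (bm_integrable P (bm_cst C)) fC.
rewrite integral0 => /fine_cvgP[_] /cvgrPdist_le /(_ e e0)[N1 _ H].
exists (N1 + N0)%N => // N /= NN; have N0N : (N0 <= N)%N by rewrite (leq_trans _ NN)// leq_addl.
have := H (N - N0)%N; rewrite /= leq_subRL// addnC => /(_ NN).
by rewrite sub0r normrN /f subnK.
Qed.

End DominatedLimit.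

Lemma Ex_norm_mono (d : measure_display) (T : measurableType d) (R : realType)
    (P : probability T R) (f g : T -> R) :
  bounded_measurable f -> bounded_measurable g -> (forall w, `|f w| <= g w) ->
  `|\int[P]_w f w| <= \int[P]_w g w.
Proof.
move=> bf bg fg; rewrite ler_norml; apply/andP; split; last first.
  by apply: Ex_le => // w; exact: le_trans (ler_norm _) (fg w).
rewrite -mulN1r -ExZ//; apply: Ex_le => //; first exact: bmZ.
by move=> w; rewrite mulN1r; have := fg w; rewrite ler_norml => /andP[].
Qed.

Section ExpectedWave.
Context {d : measure_display} {T : measurableType d} {R : realType}.
Variable P : probability T R.
Variables (n : nat) (lambda : R) (F : R -> set (set T)) (B X : 'I_n -> R -> {RV P >-> R}).
Hypothesis lambda_ge0 : 0 <= lambda.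
Hypothesis B_brownian : forall j, standard_brownian_motion (B j).
Hypothesis B_indep : independent_processes B.
Hypothesis F_filtration : filtration F.
Hypothesis F_brownian : brownian_filtration F B.
Hypothesis X_solution : solves_sde lambda F B X.
Variable t : R.
Hypothesis t_gt0 : 0 < t.
Notation mu := (@lebesgue_measure R).

Let X_adapted : forall j, adapted F (X j).
Proof. by case: X_solution. Qed.

Lemma ae_regular_path : {ae P, forall w, regular_path lambda B X w}.
Proof.
have [_ cX eqX] := X_solution.
have cX' : {ae P, forall w, forall j, {within `[0, +oo[, continuous (fun s : R => X j s w : R)}}.
  exact: filter_forall.
have cB' : {ae P, forall w, forall j, {within `[0, +oo[, continuous (fun s : R => B j s w : R)}}.
  by apply: filter_forall => j; have [] := B_brownian j.
by apply: filterS3 cX' cB' eqX => w.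
Qed.

Lemma ae_bounded_variation : {ae P, forall w, exists K : nat,
  forall N, drift_variation B X t N N w <= K%:R}.
Proof. by apply: filterS ae_regular_path => w; exact: regular_bounded_variation. Qed.

Lemma ae_no_collision : {ae P, forall w, forall j k : 'I_n, j != k ->
  mu.-negligible (collision_times t (fun s => X j s w - X k s w))}.
Proof.
apply: filter_forall => j; apply: filter_forall => k.
have [->|jk] := eqVneq j k; first exact: nearW.
have [_ cX _] := X_solution.
have := ae_collision_null B_brownian B_indep F_filtration F_brownian X_adapted
  cX t_gt0 ae_bounded_variation jk.
apply: filterS2 ae_regular_path => w [cw _ _] mu0 _; apply/negligibleP => //.
apply: measurable_collision_times => s.
by apply: continuousB; [exact: cw|exact: cw].
Qed.

Lemma tame_cover (e : R) : 0 < e -> exists K, fine (P (~` tame B X t K)) <= e.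
Proof.
move=> e0; have mt := measurable_tame B X t.
have mU : measurable (\bigcup_K tame B X t K) by exact: bigcupT_measurable.
have PU : P (\bigcup_K tame B X t K) = 1%E.
  have : P (~` \bigcup_K tame B X t K) = 0%E.
    apply/negligibleP; first exact: measurableC.
    apply: negligibleS ae_bounded_variation => w; apply: contra_not => -[K HK].
    by exists K => // N _; exact: HK.
  rewrite probability_setC// => /eqP; rewrite sube_eq//.
  by rewrite add0e => /eqP <-.
have nd : {homo tame B X t : K L / (K <= L)%N >-> (K <= L)%O}.
  move=> K L KL; apply/subsetPset => w wK N _.
  by apply: le_trans (wK N I) _; rewrite ler_nat.
have : P \o tame B X t @ \oo --> 1%E by rewrite -PU; exact: nondecreasing_cvg_mu.
move=> /fine_cvgP[_] /cvgrPdist_le /(_ e e0)[K _ /(_ K (leqnn K))/= HK].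
exists K; rewrite probability_setC// fineB// ?fin_num_measure//.
exact: le_trans (ler_norm _) HK.
Qed.

(** Provides the domination. The rate terms are O(h) per step and add up to O(t); the jumps due to
    the drift are at most 2 each and are summed under the stopping, whence K + 2. *)
Lemma remainder_sum_le (a : 'I_n -> R) (phi gam K : R) : 0 <= K ->
  (forall j, `|a j| <= 1) ->
  \forall N \near \oo, forall w,
    \sum_(i < N) alive B X t N K i w * `|remainder B X t a phi gam N i w|
    <= (`|gam| + 2 + \sum_j a j ^+ 2 / 2) * t + (K + 2).
Proof.
move=> K0 a1; set q := \sum_j _.
have q0 : 0 <= q by apply: sumr_ge0 => j _; rewrite divr_ge0// sqr_ge0.
apply: filterS3 (near_step t_gt0 (@ltr01 R)) (has_rate_near t_gt0 ltr01 (has_rate_expR gam))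
  (has_rate_near t_gt0 ltr01 (has_rate_gauss_cos a)) => N [N0 _].
set h := t / N%:R; set rho := gauss_cos a h; set ex := expR _; rewrite !mul1r -/q => he hr w.
have h0 : 0 <= h by rewrite divr_ge0// ltW.
have he' : `|ex - 1| <= (`|gam| + 1) * h.
  have -> : ex - 1 = (ex - (1 - - gam * h)) + gam * h by ring.
  by rewrite (le_trans (ler_normD _ _))// normrM (ger0_norm h0); lra.
have hr' : `|1 - rho| <= (q + 1) * h.
  have -> : 1 - rho = q * h - (rho - (1 - q * h)) by ring.
  by rewrite (le_trans (ler_normB _ _))// normrM (ger0_norm h0) (ger0_norm q0); lra.
pose jump i := `|cos (phase X a phi (grid t N i.+1) w)
     - cos (phase X a phi (grid t N i.+1) w - drift_phase B X t a N i w)|.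
have cle y : `|cos y| <= 1 :> R by rewrite ler_norml cos_geN1 cos_le1.
apply: (@le_trans _ _ (\sum_(i < N) ((`|gam| + 2 + q) * h + alive B X t N K i w * jump i))).
  apply: ler_sum => i _; have /andP[al0 al1] := alive_ge0 B X t N K i w.
  have : `|remainder B X t a phi gam N i w| <= (`|gam| + 2 + q) * h + jump i.
    rewrite /remainder -/h -/ex -/rho (le_trans (ler_normD _ _))// lerD//.
    rewrite (le_trans (ler_normB _ _))// !normrM.
    have := ler_piMr (normr_ge0 (ex - 1)) (cle (phase X a phi (grid t N i.+1) w)).
    have := ler_piMr (normr_ge0 (1 - rho)) (cle (phase X a phi (grid t N i) w)).
    by move: he' hr'; lra.
  move=> /(ler_wpM2l al0)/le_trans; apply; rewrite mulrDr lerD2r ler_piMl//.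
  by rewrite mulr_ge0// !addr_ge0.
rewrite big_split/= sumr_const card_ord lerD//.
  by rewrite -[leLHS]mulr_natl mulrCA ler_wpM2l ?addr_ge0// /h mulrC divfK// pnatr_eq0 -lt0n.
rewrite -[K in leRHS]mul1r.
apply: (@stopped_sum_le _ (drift_variation B X t N ^~ w) K
  (drift_variation_le _ _ _ _ _) jump) => //.
- by rewrite /drift_variation big_ord0.
move=> i _; split.
  by rewrite (le_trans (ler_normB _ _))// -[leRHS]/(1 + 1) lerD.
apply: le_trans (drift_phase_le _ _ _ _ _ _ a1).
by rewrite (le_trans (cos_lipschitz _ _))// subKr.
Qed.

Section FixedSize.
Variables (m : nat) (phi : R).
Notation gam := (growth n lambda m).
Notation wv S := (wave X (member S) phi gam).

Let gam_ge0 : 0 <= gam.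
Proof. by rewrite addr_ge0 ?divr_ge0// mulr_ge0// mulr_ge0. Qed.

Lemma wave_le (S : {set 'I_n}) s w : s <= t -> `|wv S s w| <= expR (gam * t).
Proof.
move=> st; rewrite /wave normrM (ger0_norm (expR_ge0 _)) -[leRHS]mulr1.
apply: ler_pM => //.
  by rewrite ler_expR ler_wpM2l.
by rewrite ler_norml cos_geN1 cos_le1.
Qed.

Lemma sum_subsets_le (f : {set 'I_n} -> R) (c : R) : 0 <= c ->
  (forall S, `|f S| <= c) ->
  `|\sum_(S : {set 'I_n} | #|S| == m) f S| <= #|{: {set 'I_n}}|%:R * c.
Proof.
move=> c0 fc; rewrite (le_trans (ler_norm_sum _ _ _))// big_mkcond/=.
apply: (@le_trans _ _ (\sum_(S : {set 'I_n}) c)); last by rewrite sumr_const mulr_natl.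
by apply: ler_sum => S _; case: ifP.
Qed.

Let grid_full N : (0 < N)%N -> grid t N N = t.
Proof. by move=> N0; rewrite /grid mulrC divfK// pnatr_eq0 -lt0n. Qed.

Let grid_in N i : (i <= N)%N -> grid t N i <= t.
Proof.
case: N => [|N] iN; last by rewrite -[leRHS](@grid_full N.+1)//; exact: grid_le.
by move: iN; rewrite leqn0 => /eqP ->; rewrite /grid mul0r ltW.
Qed.

Let member_le (S : {set 'I_n}) j : `|member S j| <= 1 :> R.
Proof. by rewrite normr_nat lern1 leq_b1. Qed.

Definition stopped_remainder K N w : R := \sum_(S : {set 'I_n} | #|S| == m)
  \sum_(i < N) alive B X t N K i w *
    (expR (gam * grid t N i) * remainder B X t (member S) phi gam N i w).

Lemma bm_stopped_remainder K N : bounded_measurable (stopped_remainder K N).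
Proof.
apply: bm_sum => S _; apply: bm_sum => i _; apply: bmM.
  exact: (bm_alive_full F_filtration F_brownian X_adapted t_gt0).
by apply: bmZ; exact: bm_remainder.
Qed.

Lemma stopped_remainder_bound K : 0 <= K ->
  exists C, \forall N \near \oo, forall w, `|stopped_remainder K N w| <= C.
Proof.
move=> K0; exists (\sum_(S : {set 'I_n} | #|S| == m) expR (gam * t) *
  ((`|gam| + 2 + \sum_j member S j ^+ 2 / 2) * t + (K + 2))).
have : \forall N \near \oo, forall S : {set 'I_n}, forall w,
    \sum_(i < N) alive B X t N K i w * `|remainder B X t (member S) phi gam N i w|
    <= (`|gam| + 2 + \sum_j member S j ^+ 2 / 2) * t + (K + 2).
  by apply: filter_forall => S; exact: remainder_sum_le.
apply: filterS => N H w; rewrite (le_trans (ler_norm_sum _ _ _))//.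
apply: ler_sum => S _; apply: le_trans (ler_wpM2l (expR_ge0 _) (H S w)).
rewrite (le_trans (ler_norm_sum _ _ _))// mulr_sumr; apply: ler_sum => i _.
have /andP[al0 _] := alive_ge0 B X t N K i w.
rewrite !normrM (ger0_norm al0) (ger0_norm (expR_ge0 _)) mulrCA.
apply: ler_wpM2r; first exact: mulr_ge0.
by rewrite ler_expR ler_wpM2l// grid_in// ltnW.
Qed.

(** Smallness appears only after summing over S within a step. The sums are therefore exchanged; the
    stopping weight and the exponential are common to all S of size m and factor out. *)
Lemma stopped_remainder_cvg0 K : {ae P, forall w, forall e : R, 0 < e ->
  \forall N \near \oo, `|stopped_remainder K N w| <= e}.
Proof.
apply: filterS2 ae_regular_path ae_no_collision => w rw cw e e0.
pose V := \sum_j \int[mu]_(s in `[0, t]) `|cot_drift lambda X j s w|.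
have V0 : 0 <= V by apply: sumr_ge0 => j _; exact: Rintegral_ge0.
have E0 : 0 < expR (gam * t) := expR_gt0 _.
have D0 : 0 < expR (gam * t) * (t + V) by rewrite mulr_gt0// ltr_wpDr.
apply: filterS2 (near_step t_gt0 ltr01)
  (remainder_sum_small lambda_ge0 t_gt0 rw cw m phi (divr_gt0 e0 D0)) => N [N0 _] H.
rewrite /stopped_remainder exchange_big/= (le_trans (ler_norm_sum _ _ _))//.
set e' := e / _ in H.
apply: (@le_trans _ _ (\sum_(i < N) expR (gam * t) * (e' * (t / N%:R + mass lambda X t N i w)))).
  apply: ler_sum => i _; rewrite -mulr_sumr -mulr_sumr mulrA normrM.
  apply: ler_pM => //; last exact: H.
  have /andP[al0 al1] := alive_ge0 B X t N K i w.
  rewrite normrM (ger0_norm al0) (ger0_norm (expR_ge0 _)) -[leRHS]mul1r.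
  apply: ler_pM => //.
  by rewrite ler_expR ler_wpM2l// grid_in// ltnW.
rewrite -mulr_sumr -mulr_sumr big_split/= sumr_const card_ord.
have -> : t / N%:R *+ N = t by rewrite -[LHS]mulr_natr divfK// pnatr_eq0 -lt0n.
have -> : e = expR (gam * t) * (e' * (t + V)).
  by rewrite /e' mulrCA divfK// gt_eqF.
apply: ler_wpM2l; first exact: ltW.
apply: ler_wpM2l; first by rewrite divr_ge0 ?ltW.
by rewrite lerD2l; exact: (sum_mass_le t_gt0 rw).
Qed.

Lemma Ex_wave_sum_const :
  \int[P]_w (\sum_(S : {set 'I_n} | #|S| == m) wv S t w) =
  \int[P]_w (\sum_(S : {set 'I_n} | #|S| == m) wv S 0 w).
Proof.
pose W s w := \sum_(S : {set 'I_n} | #|S| == m) wv S s w.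
pose M : R := #|{: {set 'I_n}}|%:R * expR (gam * t).
have bW s : bounded_measurable (W s) by apply: bm_sum => S _; exact: bm_wave.
have M0 : 0 <= M by rewrite mulr_ge0// expR_ge0.
rewrite -/(W t) -/(W 0); apply/eqP; rewrite -subr_eq0 -normr_le0.
apply/ler_addgt0Pr => e e0; rewrite add0r.
have M4 : 0 < 2 * (4 * M + 1) by lra.
(* K is chosen first, to make the untamed event improbable; then N, to make the mean stopped
   remainder small for this K. *)
have [K HK] := tame_cover (divr_gt0 e0 M4).
have [C HC] := stopped_remainder_bound (ler0n R K).
have Zlim := Ex_dominated_cvg0 (bm_stopped_remainder K%:R) HC (stopped_remainder_cvg0 K%:R).
have [N [N0 ZN]] : exists N, (0 < N)%N /\
    `|\int[P]_w stopped_remainder K%:R N w| <= e / 2.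
  have [N1 _ H1] := Zlim _ (divr_gt0 e0 (ltr0Sn R 1)).
  by exists N1.+1; split => //; apply: H1 => /=.
pose G w := \sum_(S : {set 'I_n} | #|S| == m) \sum_(i < N) alive B X t N K%:R i w *
    (wv S (grid t N i.+1) w - wv S (grid t N i) w).
have bG1 (S : {set 'I_n}) : bounded_measurable (fun w => \sum_(i < N) alive B X t N K%:R i w *
    (wv S (grid t N i.+1) w - wv S (grid t N i) w)).
  apply: bm_sum => i _; apply: bmM; last by apply: bmB; exact: bm_wave.
  exact: (bm_alive_full F_filtration F_brownian X_adapted t_gt0).
have bG : bounded_measurable G by apply: bm_sum => S _; exact: bG1.
have EG : \int[P]_w G w = \int[P]_w stopped_remainder K%:R N w.
  rewrite !Ex_sum//.
    apply: eq_bigr => S _.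
    exact: (Ex_alive_wave B_brownian B_indep F_filtration F_brownian X_adapted t_gt0).
  move=> S _; apply: bm_sum => i _; apply: bmM.
    exact: (bm_alive_full F_filtration F_brownian X_adapted t_gt0).
  by apply: bmZ; exact: bm_remainder.
have grid0 : grid t N 0 = 0 by rewrite /grid mul0r.
(* On [tame] K the stopped sum telescopes completely. Elsewhere W t and W 0 are at most M each and
   the stopped telescoping sum at most 2 M, which gives 4 M. *)
have path w : `|W t w - W 0 w - G w| <= 4 * M * \1_(~` tame B X t K) w.
  rewrite indicE; case: (boolP (w \in tame B X t K)) => wK.
    have -> : w \in ~` tame B X t K = false by rewrite in_setC wK.
    rewrite mulr0 /W -sumrB -sumrB big1 ?normr0// => S _.
    have gK : drift_variation B X t N N w <= K%:R by move/set_mem : wK => /(_ N I).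
    have := @stopped_telescope_id _ (drift_variation B X t N ^~ w) K%:R
      (drift_variation_le _ _ _ _ _) (fun i => wv S (grid t N i) w) N gK.
    by rewrite /alive => ->; rewrite grid_full// grid0 subrr.
  have -> : w \in ~` tame B X t K by rewrite in_setC.
  rewrite mulr1 (_ : 4 * M = M + M + 2 * M); last by ring.
  have t0 := ltW t_gt0; have WM s : s <= t -> `|W s w| <= M.
    by move=> st; apply: sum_subsets_le => [|S]; [exact: expR_ge0|exact: wave_le].
  rewrite (le_trans (ler_normB _ _))// lerD//.
    by rewrite (le_trans (ler_normB _ _))// lerD// WM.
  rewrite /M mulrCA; apply: sum_subsets_le => [|S].
    by rewrite mulr_ge0// expR_ge0.
  apply: (@stopped_telescope_le _ (drift_variation B X t N ^~ w) K%:R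
      (drift_variation_le _ _ _ _ _) (fun i => wv S (grid t N i) w)) => i iN.
  by apply: wave_le; exact: grid_in.
have bI : bounded_measurable (\1_(~` tame B X t K) : T -> R).
  by apply: bm_indic; apply: measurableC; exact: measurable_tame.
have := Ex_norm_mono P (bmB (bmB (bW t) (bW 0)) bG) (bmZ (4 * M) bI) path.
rewrite ExZ// Ex_indic; last by apply: measurableC; exact: measurable_tame.
rewrite !ExB//; last exact: bmB.
rewrite EG => H; set p := fine _ in HK H.
have p0 : 4 * M * p <= e / 2.
  apply: (@le_trans _ _ ((4 * M + 1) * (e / (2 * (4 * M + 1))))).
    apply: ler_pM => //; [by rewrite mulr_ge0|by rewrite fine_ge0|lra].
  by have -> : (4 * M + 1) * (e / (2 * (4 * M + 1))) = e / 2 by [field; rewrite gt_eqF//; lra].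
rewrite -[X in `|X| <= _](subrK (\int[P]_w stopped_remainder K%:R N w)).
rewrite (le_trans (ler_normD _ _))//; lra.
Qed.

End FixedSize.

End ExpectedWave.

Section SubsetSums.
Context {d : measure_display} {T : measurableType d} {R : realType}.
Variable P : probability T R.
Variables (n : nat) (X : 'I_n -> R -> {RV P >-> R}).
Hypothesis X_init : {ae P, forall w, forall j, X j 0 w = 0}.

Lemma sum_card_eq (m : nat) (c : R) :
  \sum_(S : {set 'I_n} | #|S| == m) c = 'C(n, m)%:R * c.
Proof.
rewrite sumr_const mulr_natl; congr (_ *+ _).
by rewrite -[n in RHS]card_ord -card_draws cardsE.
Qed.

Lemma Ex_cos_phase0 (a : 'I_n -> R) (phi : R) :
  \int[P]_w cos (phase X a phi 0 w) = cos phi.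
Proof.
rewrite -[RHS](Ex_cst P); congr fine; apply: ae_eq_integral => //.
- by apply/measurable_EFinP; exact: (bm_cos (measurable_phase X a phi 0)).1.
- apply: filterS X_init => w X0 _; congr (cos _)%:E.
  by rewrite /phase big1 ?addr0// => j _; rewrite X0 mulr0.
Qed.

Lemma Ex_cos_subset_sum (lambda : R) (F : R -> set (set T)) (B : 'I_n -> R -> {RV P >-> R})
    (t : R) (m : nat) (phi : R) :
  0 <= lambda -> (forall j, standard_brownian_motion (B j)) ->
  independent_processes B -> filtration F -> brownian_filtration F B ->
  solves_sde lambda F B X -> 0 <= t ->
  \sum_(S : {set 'I_n} | #|S| == m) \int[P]_w cos (phase X (member S) phi t w) =
  'C(n, m)%:R * expR (- (growth n lambda m * t)) * cos phi.
Proof.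
(* The grid estimates require t > 0; at t = 0 the initial condition alone gives the value. *)
move=> lambda_ge0 BB IB FF FB XS; rewrite le_eqVlt => /predU1P[<-|t0].
  under eq_bigr do rewrite Ex_cos_phase0.
  by rewrite sum_card_eq mulr0 oppr0 expR0 mulr1.
have bc (S : {set 'I_n}) s : bounded_measurable (fun w => cos (phase X (member S) phi s w)).
  exact: bm_cos (measurable_phase _ _ _ _).
have := Ex_wave_sum_const lambda_ge0 BB IB FF FB XS t0 m phi.
rewrite !Ex_sum; [|by move=> *; exact: bm_wave..].
under eq_bigr do rewrite ExZ//.
under [RHS]eq_bigr do rewrite ExZ// mulr0 expR0 mul1r Ex_cos_phase0.
rewrite sum_card_eq -mulr_sumr => E.
have g0 : expR (growth n lambda m * t) != 0 by rewrite gt_eqF// expR_gt0.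
by apply: (mulfI g0); rewrite E expRN; field.
Qed.

End SubsetSums.

(** * Expansion of the polynomial *)

Section ComplexExpansion.
Context {R : realType}.
Implicit Types (x y : R[i]) (a b : R).

Lemma ReD x y : complex.Re (x + y) = complex.Re x + complex.Re y.
Proof. by case: x => ? ?; case: y. Qed.

Lemma ImD x y : complex.Im (x + y) = complex.Im x + complex.Im y.
Proof. by case: x => ? ?; case: y. Qed.

Lemma Re_sum (I : finType) (f : I -> R[i]) :
  complex.Re (\sum_i f i) = \sum_i complex.Re (f i).
Proof. by apply: (big_rec2 (fun u v => complex.Re u = v)) => // i u v _ <-; exact: ReD. Qed.

Lemma Im_sum (I : finType) (f : I -> R[i]) :
  complex.Im (\sum_i f i) = \sum_i complex.Im (f i).
Proof. by apply: (big_rec2 (fun u v => complex.Im u = v)) => // i u v _ <-; exact: ImD. Qed.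

Lemma expi0 : expi (0 : R) = 1.
Proof. by rewrite /expi cos0 sin0. Qed.

Lemma expiD a b : expi (a + b) = expi a * expi b.
Proof. by rewrite /expi cosD [sin (a + b)]sinD [sin a * _ + _]addrC. Qed.

(** The sine is written as a shifted cosine because the moments are computed for cosines with a free
    phase. *)
Lemma Re_mul_expi x a :
  complex.Re (x * expi a) = complex.Re x * cos a - complex.Im x * cos (a - pi / 2).
Proof. by case: x => u v; rewrite cosBpihalf. Qed.

Lemma Im_mul_expi x a :
  complex.Im (x * expi a) = complex.Re x * cos (a - pi / 2) + complex.Im x * cos a.
Proof. by case: x => u v; rewrite cosBpihalf. Qed.

Lemma Re_scale_real x a : complex.Re (a%:C * x) = a * complex.Re x.
Proof. by case: x => u v /=; rewrite mul0r subr0. Qed.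

Lemma Im_scale_real x a : complex.Im (a%:C * x) = a * complex.Im x.
Proof. by case: x => u v /=; rewrite mul0r addr0. Qed.

Lemma prod_sub_expi (n : nat) (x : R[i]) (y : 'I_n -> R) :
  \prod_(j < n) (x - expi (y j)) = \sum_(S : {set 'I_n})
    (-1) ^+ #|S| * x ^+ (n - #|S|) * expi (\sum_j (j \in S)%:R * y j).
Proof.
under eq_bigr do rewrite addrC.
rewrite bigA_distr; apply: eq_bigr => S _.
rewrite (bigID (mem S))/= [X in X * _](eq_bigr (fun j => - expi (y j))); last by move=> j ->.
rewrite [X in _ * X](eq_bigr (fun=> x)); last by move=> j /negbTE ->.
rewrite prodrN [X in _ * X = _](eq_bigl (fun j => j \in (~: S)%SET)) => [|j]; last by rewrite !inE.
rewrite prodr_const (cardsCs (~: S)) finset.setCK card_ord.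
rewrite mulrAC; congr (_ * _ * _).
rewrite -(big_morph expi expiD expi0); congr expi.
by rewrite big_mkcond/=; apply: eq_bigr => j _; case: ifP => _; rewrite ?mul1r ?mul0r.
Qed.

End ComplexExpansion.

(** The phase 0 gives the cosine moments p m, and the phase - pi / 2 gives zero sine moments. So the
    sum of exp (i \sum_(j in S) X_j) over S of size m has the real mean p m, and the coefficients of
    the polynomial pass through unchanged. *)
Lemma complex_expectation_circle_poly (d : measure_display) (T : measurableType d) (R : realType)
    (P : probability T R) (n : nat) (X : 'I_n -> R -> {RV P >-> R}) (x : R[i]) (t : R)
    (p : nat -> R) :
  (forall (m : nat) (phi : R),
    \sum_(S : {set 'I_n} | #|S| == m) \int[P]_w cos (phase X (member S) phi t w)
    = p m * cos phi) ->
  complex_integrable P (circle_poly X x t) /\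
  complex_expectation P (circle_poly X x t) =
  \sum_(m < n.+1) (p m)%:C * ((-1) ^+ m * x ^+ (n - m)).
Proof.
move=> pE; pose c m : R[i] := (-1) ^+ m * x ^+ (n - m).
pose th (S : {set 'I_n}) phi w := cos (phase X (member S) phi t w).
have bth S phi : bounded_measurable (th S phi) := bm_cos (measurable_phase _ _ _ _).
have polyE w : circle_poly X x t w =
    \sum_(S : {set 'I_n}) c #|S| * expi (phase X (member S) 0 t w).
  by rewrite /circle_poly prod_sub_expi; apply: eq_bigr => S _; rewrite /phase add0r.
have thE S w : th S (- (pi / 2)) w = cos (phase X (member S) 0 t w - pi / 2).
  by rewrite /th /phase add0r addrC.
have ReE w : complex.Re (circle_poly X x t w) = \sum_(S : {set 'I_n})
    (complex.Re (c #|S|) * th S 0 w - complex.Im (c #|S|) * th S (- (pi / 2)) w).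
  rewrite polyE Re_sum; apply: eq_bigr => S _.
  by rewrite Re_mul_expi thE.
have ImE w : complex.Im (circle_poly X x t w) = \sum_(S : {set 'I_n})
    (complex.Re (c #|S|) * th S (- (pi / 2)) w + complex.Im (c #|S|) * th S 0 w).
  rewrite polyE Im_sum; apply: eq_bigr => S _.
  by rewrite Im_mul_expi thE.
have bRe1 (S : {set 'I_n}) : bounded_measurable (fun w =>
    complex.Re (c #|S|) * th S 0 w - complex.Im (c #|S|) * th S (- (pi / 2)) w).
  by apply: bmB; exact: bmZ.
have bIm1 (S : {set 'I_n}) : bounded_measurable (fun w =>
    complex.Re (c #|S|) * th S (- (pi / 2)) w + complex.Im (c #|S|) * th S 0 w).
  by apply: bmD; exact: bmZ.
have bRe : bounded_measurable (fun w => complex.Re (circle_poly X x t w)).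
  by rewrite (funext ReE); apply: bm_sum => S _; exact: bRe1.
have bIm : bounded_measurable (fun w => complex.Im (circle_poly X x t w)).
  by rewrite (funext ImE); apply: bm_sum => S _; exact: bIm1.
split; first by split; exact: (bm_integrable P).
have by_card (f : {set 'I_n} -> R) :
    \sum_(S : {set 'I_n}) f S = \sum_(m < n.+1) \sum_(S : {set 'I_n} | #|S| == m) f S.
  have cardn (S : {set 'I_n}) : (#|S| < n.+1)%N.
    by rewrite ltnS -[n in (_ <= n)%N]card_ord max_card.
  rewrite (partition_big (fun S : {set 'I_n} => Ordinal (cardn S)) xpredT)//=.
have combine (u v : nat -> R) (phi psi : R) :
    \int[P]_w (\sum_(S : {set 'I_n}) (u #|S| * th S phi w + v #|S| * th S psi w)) =
    \sum_(m < n.+1) p m * (u m * cos phi + v m * cos psi).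
  rewrite Ex_sum => [|S _]; last by apply: bmD; exact: bmZ.
  rewrite by_card; apply: eq_bigr => m _.
  rewrite (eq_bigr (fun S => u m * \int[P]_w th S phi w + v m * \int[P]_w th S psi w)).
    by rewrite big_split/= -!mulr_sumr !pE; ring.
  by move=> S /eqP <-; rewrite ExD ?ExZ//; exact: bmZ.
have cosNpihalf : cos (- (pi / 2)) = 0 :> R by rewrite cosN cos_pihalf.
rewrite /complex_expectation unlock.
set rhs := \sum_(m < n.+1) _; transitivity (complex.Re rhs +i* complex.Im rhs); last by case: rhs.
congr (_ +i* _).
  rewrite -[LHS]/(\int[P]_w complex.Re (circle_poly X x t w)).
  under eq_Rintegral do rewrite ReE.
  rewrite /rhs Re_sum.
  under eq_Rintegral do under eq_bigr do rewrite -mulNr.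
  rewrite (combine (fun m => complex.Re (c m)) (fun m => - complex.Im (c m))).
  apply: eq_bigr => m _; rewrite Re_scale_real cos0 cosNpihalf -/(c m); ring.
rewrite -[LHS]/(\int[P]_w complex.Im (circle_poly X x t w)).
under eq_Rintegral do rewrite ImE.
rewrite /rhs Im_sum.
rewrite (combine (fun m => complex.Re (c m)) (fun m => complex.Im (c m))).
by apply: eq_bigr => m _; rewrite Im_scale_real cos0 cosNpihalf -/(c m); ring.
Qed.

(** The power j of the rescaled variable contributes exp (j t / 2), which turns the prefactor exp (-
    n t / 2) into exp (- (n - j) t / 2). *)
Lemma unitary_hermite_rescale (R : realType) (n : nat) (lambda t : R) (x : R[i]) :
  \sum_(j < n.+1) (-1) ^+ (n - j) * 'C(n, j)%:R
      * (expR (- (1 / 2 * (n - j)%:R * t)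
               - lambda * j%:R * (n - j)%:R * t))%:C * x ^+ j
    = (expR (- (1 / 2 * n%:R * t)))%:C
      * unitary_hermite n ((expR (t / 2))%:C * x) (2 * lambda * t).
Proof.
rewrite /unitary_hermite mulr_sumr; apply: eq_bigr => j _.
have jn : (j <= n)%N by rewrite -ltnS.
have -> : expR (- (1 / 2 * (n - j)%:R * t) - lambda * j%:R * (n - j)%:R * t) =
    expR (- (1 / 2 * n%:R * t)) * expR (- (2 * lambda * t * j%:R * (n - j)%:R / 2))
    * expR (t / 2) ^+ j.
  by rewrite -expRM_natl -!expRD natrB//; congr expR; field.
by rewrite exprMn !rmorphM rmorphXn/=; ring.
Qed.

Theorem theorem2p10 (d : measure_display) (T : measurableType d) (R : realType)
    (P : probability T R) (n : nat) (lambda : R)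
    (F : R -> set (set T)) (B X : 'I_n -> R -> {RV P >-> R})
    (lambda_gt0 : 0 < lambda)
    (B_brownian : forall j, standard_brownian_motion (B j))
    (B_indep : independent_processes B)
    (F_filtration : filtration F)
    (F_brownian : brownian_filtration F B)
    (X_solution : solves_sde lambda F B X)
    (X_ordered : {ae P, forall w, forall t, 0 <= t ->
       forall j k : 'I_n, (j <= k)%N -> X j t w <= X k t w})
    (X_init : {ae P, forall w, forall j, X j 0 w = 0})
    (t : R) (t_ge0 : 0 <= t) (x : R[i]) :
  [/\ complex_integrable P (circle_poly X x t),
      complex_expectation P (circle_poly X x t)
        = \sum_(j < n.+1) (-1) ^+ (n - j) * 'C(n, j)%:R
            * (expR (- (1 / 2 * (n - j)%:R * t)
                     - lambda * j%:R * (n - j)%:R * t))%:C * x ^+ j &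
      \sum_(j < n.+1) (-1) ^+ (n - j) * 'C(n, j)%:R
          * (expR (- (1 / 2 * (n - j)%:R * t)
                   - lambda * j%:R * (n - j)%:R * t))%:C * x ^+ j
        = (expR (- (1 / 2 * n%:R * t)))%:C
          * unitary_hermite n ((expR (t / 2))%:C * x) (2 * lambda * t)].
Proof.
have [intP exE] := @complex_expectation_circle_poly _ _ _ P n X x t _
  (fun m phi => Ex_cos_subset_sum X_init m phi (ltW lambda_gt0) B_brownian B_indep
     F_filtration F_brownian X_solution t_ge0).
split => //; last exact: unitary_hermite_rescale.
(* The expansion is indexed by the size m of S, which goes with the power n - m of x; the statement
   is indexed by the power. *)
rewrite exE (reindex_inj rev_ord_inj)/=; apply: eq_bigr => j _.
have jn : (j <= n)%N by rewrite -ltnS.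
rewrite subSS subKn// bin_sub// /growth subKn// rmorphM rmorph_nat.
have -> : - (((n - j)%:R / 2 + lambda * ((n - j)%:R * j%:R)) * t) =
   - (1 / 2 * (n - j)%:R * t) - lambda * j%:R * (n - j)%:R * t by field.
by ring.
Qed.
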